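(* There exist a unitary operator $U$ and a rank $1$ operator $R$ on the complex Hilbert space $\ell_{2}(\mathbb{N})$ such that the operator $T=U+R$ is hypercyclic on $\ell_{2}(\mathbb{N})$.
   Context: All operators are bounded and linear. A bounded linear operator $T$ on a separable infinite-dimensional Banach space $X$ is called hypercyclic if there exists a vector $x\in X$ whose orbit $\{T^{n}x : n\geq 0\}$ is dense in $X$. Here $\ell_2(\mathbb{N})$ is the complex Hilbert space of square-summable complex sequences, with the norm topology. *)

(* Defs.v *)
From HB Require Import structures.
From mathcomp Require Import all_boot all_order all_algebra.
From mathcomp Require Import complex.
From mathcomp Require Import ring lra.
From mathcomp Require Import all_classical all_reals all_analysis.

Set Implicit Arguments.
Unset Strict Implicit.
Unset Printing Implicit Defensive.

Import Order.TTheory GRing.Theory Num.Theory.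
Import numFieldNormedType.Exports.
Import ComplexField.Normc.

Local Open Scope classical_set_scope.
Local Open Scope complex_scope.
Local Open Scope ring_scope.

Section operators.
Context {K : numFieldType} {V W : normedModType K}.

Definition bounded_operator (T : V -> W) : Prop :=
  exists M : K, forall x, `|T x| <= M * `|x|.

Definition rank_one (T : V -> W) : Prop :=
  exists2 v : W, v != 0 & range T = range (fun c : K => c *: v).

End operators.

Lemma bounded_operatorP {K : numFieldType} {V W : normedModType K}
  (T : {linear V -> W}) : bounded_operator T <-> continuous T.
Proof.
rewrite -linear_bounded_continuous; split => [[M TM]|/linear_boundedP nT].
  apply/linear_boundedP; near=> r => x; apply: le_trans (TM x) _.
  rewrite -[leLHS]ger0_norm ?(le_trans _ (TM x))// normrM normr_id.
  by apply: ler_wpM2r => //; near: r; exact: nbhs_pinfty_ge (normr_real M).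
by have [M] := filter_ex nT; exists M.
Unshelve. all: by end_near. Qed.

Definition hypercyclic {K : numFieldType} {X : completeNormedModType K}
    (T : X -> X) : Prop :=
  exists x : X, dense [set iter n T x | n in [set: nat]].

Definition square_summable {R : realType} (x : nat -> R[i]) : Prop :=
  cvgn (series (fun n => normc (x n) ^+ 2)).

Definition ell2_pred {R : realType} : {pred (nat -> R[i])} :=
  fun x => `[< square_summable x >].

Record ell2 (R : realType) := Ell2 {
  ell2_seq :> nat -> R[i];
  _ : ell2_seq \in ell2_pred
}.

Section ell2_lmodule.
Context {R : realType}.
Implicit Types x y : nat -> R[i].

Lemma normc_ge0 (z : R[i]) : 0 <= normc z.
Proof. by case: z => a b; exact: sqrtr_ge0. Qed.

Lemma sqr_normcE (z : R[i]) : normc z ^+ 2 = complex.Re z ^+ 2 + complex.Im z ^+ 2.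
Proof. by case: z => a b /=; rewrite sqr_sqrtr// addr_ge0// sqr_ge0. Qed.

Lemma sqr_normcD_le (z w : R[i]) :
  normc (z + w) ^+ 2 <= 2 * normc z ^+ 2 + 2 * normc w ^+ 2.
Proof.
rewrite !sqr_normcE; case: z w => [a b] [c d] /=; rewrite -subr_ge0.
by rewrite [leRHS](_ : _ = (a - c) ^+ 2 + (b - d) ^+ 2) ?addr_ge0 ?sqr_ge0//; ring.
Qed.

Lemma square_summable_le x (M : R) :
  (forall n, series (fun k => normc (x k) ^+ 2) n <= M) -> square_summable x.
Proof.
move=> xM; apply: nondecreasing_is_cvgn.
  by apply/nondecreasing_series => n _ _; exact: sqr_ge0.
by exists M => _ [n _ <-].
Qed.

Lemma sqrZE (c : R[i]) x : (fun n => normc ((c *: x) n) ^+ 2) =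
  normc c ^+ 2 *: (fun n => normc (x n) ^+ 2).
Proof. by apply/funext => n; rewrite /= normcM exprMn. Qed.

Lemma square_summableZ (c : R[i]) x :
  square_summable x -> square_summable (c *: x).
Proof. by move=> sx; rewrite /square_summable sqrZE; exact: is_cvg_seriesZ. Qed.

Lemma square_summableD x y :
  square_summable x -> square_summable y -> square_summable (x + y).
Proof.
move=> sx sy; apply: (@series_le_cvg _ _
  ((2 : R) *: (fun n => normc (x n) ^+ 2) + (2 : R) *: (fun n => normc (y n) ^+ 2))).
- by move=> n; exact: sqr_ge0.
- by move=> n; rewrite addr_ge0// mulr_ge0// sqr_ge0.
- by move=> n; exact: sqr_normcD_le.
by apply: is_cvg_seriesD; exact: is_cvg_seriesZ.
Qed.

Lemma ell2_submod_closed : GRing.submod_closed (@ell2_pred R).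
Proof.
split=> [|c x y /asboolP sx /asboolP sy]; apply/asboolP.
  apply: (@square_summable_le _ 0) => n.
  rewrite /series/= big1// => k _.
  by rewrite -[LHS]/(normc (0 : R[i]) ^+ 2) normc0 expr0n.
by apply: square_summableD => //; exact: square_summableZ.
Qed.

End ell2_lmodule.

HB.instance Definition _ (R : realType) :=
  GRing.isSubmodClosed.Build R[i] (nat -> R[i]) (@ell2_pred R) ell2_submod_closed.
HB.instance Definition _ (R : realType) := [isSub for @ell2_seq R].
HB.instance Definition _ (R : realType) := [Choice of ell2 R by <:].
HB.instance Definition _ (R : realType) :=
  [SubChoice_isSubLmodule of ell2 R by <:].

Section ell2_norm.
Context {R : realType}.
Implicit Types x y : ell2 R.

Lemma ell2P x : square_summable x.
Proof. exact/asboolP/(valP x). Qed.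
Arguments ell2P : clear implicits.

(* The norm is real-valued here; the norm of a normed module over R[i] is the
   image of this number in R[i]. *)
Definition ell2_norm x : R :=
  Num.sqrt (limn (series (fun n => normc (x n) ^+ 2))).

Lemma ell2_partial_le x N :
  series (fun n => normc (x n) ^+ 2) N <= limn (series (fun n => normc (x n) ^+ 2)).
Proof.
apply: nondecreasing_cvgn_le; last exact: ell2P.
by apply/nondecreasing_series => n _ _; exact: sqr_ge0.
Qed.

Lemma sqr_ell2_norm x :
  ell2_norm x ^+ 2 = limn (series (fun n => normc (x n) ^+ 2)).
Proof.
rewrite sqr_sqrtr//; apply: le_trans (ell2_partial_le x 0).
by rewrite /series/= big_geq.
Qed.

Lemma ell2_norm_ge0 x : 0 <= ell2_norm x.
Proof. exact: sqrtr_ge0. Qed.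

Lemma ell2_norm_le x (M : R) : 0 <= M ->
  (forall N, series (fun n => normc (x n) ^+ 2) N <= M ^+ 2) -> ell2_norm x <= M.
Proof.
move=> M0 xM; rewrite -(@ler_pXn2r _ 2)// ?nnegrE ?ell2_norm_ge0//.
by rewrite sqr_ell2_norm; apply: limr_le; [exact: ell2P|exact: nearW].
Qed.

Lemma normc_le_ell2_norm x n : normc (x n) <= ell2_norm x.
Proof.
rewrite -(@ler_pXn2r _ 2)// ?nnegrE ?ell2_norm_ge0 ?normc_ge0//.
rewrite sqr_ell2_norm; apply: le_trans (ell2_partial_le x n.+1).
by rewrite /series/= big_nat_recr//= lerDr sumr_ge0// => k _; exact: sqr_ge0.
Qed.

Lemma ell2_norm_eq0 x : ell2_norm x = 0 -> x = 0.
Proof.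
move=> x0; apply/val_inj/funext => n; apply: eq0_normc; apply/eqP.
by rewrite eq_le normc_ge0 -x0 normc_le_ell2_norm.
Qed.

Lemma ell2_normZ (c : R[i]) x : ell2_norm (c *: x) = normc c * ell2_norm x.
Proof.
rewrite /ell2_norm (sqrZE c x) lim_seriesZ; last exact: ell2P.
rewrite -[_ *: _]/(_ * _) sqrtrM ?sqr_ge0//.
by rewrite sqrtr_sqr ger0_norm// normc_ge0.
Qed.

Lemma ler_ell2_normD x y : ell2_norm (x + y) <= ell2_norm x + ell2_norm y.
Proof.
have [/eqP/ell2_norm_eq0->|x0] := boolP (ell2_norm x == 0).
  by rewrite add0r lerDr ell2_norm_ge0.
have [/eqP/ell2_norm_eq0->|y0] := boolP (ell2_norm y == 0).
  by rewrite addr0 lerDl ell2_norm_ge0.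
have X0 : 0 < ell2_norm x by rewrite lt_neqAle eq_sym x0 ell2_norm_ge0.
have Y0 : 0 < ell2_norm y by rewrite lt_neqAle eq_sym y0 ell2_norm_ge0.
set A := ell2_norm x in x0 X0 *; set B := ell2_norm y in y0 Y0 *.
apply: ell2_norm_le => [|N]; first by rewrite addr_ge0// ltW.
have pt n : normc ((x + y) n) ^+ 2 <=
    (1 + B / A) * normc (x n) ^+ 2 + (1 + A / B) * normc (y n) ^+ 2.
  apply: (@le_trans _ _ ((normc (x n) + normc (y n)) ^+ 2)).
    rewrite ler_pXn2r// ?nnegrE ?normc_ge0 ?addr_ge0 ?normc_ge0//.
    exact: le_normcD.
  move: (normc (x n)) (normc (y n)) => a b; rewrite -subr_ge0.
  rewrite [leRHS](_ : _ = (B * a - A * b) ^+ 2 / (A * B)).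
    by rewrite divr_ge0 ?sqr_ge0// mulr_ge0// ltW.
  by field; rewrite x0 y0.
apply: (@le_trans _ _ (\sum_(0 <= n < N)
    ((1 + B / A) * normc (x n) ^+ 2 + (1 + A / B) * normc (y n) ^+ 2))).
  by apply: ler_sum => n _; exact: pt.
rewrite big_split/= -!mulr_sumr.
rewrite [leRHS](_ : _ = (1 + B / A) * A ^+ 2 + (1 + A / B) * B ^+ 2); last first.
  by field; rewrite x0 y0.
by apply: lerD; apply: ler_wpM2l;
  rewrite ?addr_ge0 ?divr_ge0 ?(ltW X0) ?(ltW Y0)// sqr_ell2_norm; exact: ell2_partial_le.
Qed.

Let norm x : R[i] := (ell2_norm x)%:C.

Let norm_triangle x y : norm (x + y) <= norm x + norm y.
Proof. by rewrite /norm -rmorphD/= lecR ler_ell2_normD. Qed.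

Let normZ (c : R[i]) x : norm (c *: x) = `|c| * norm x.
Proof. by rewrite /norm ell2_normZ rmorphM. Qed.

Let norm_eq0 x : norm x = 0 -> x = 0.
Proof. by case=> /ell2_norm_eq0. Qed.

HB.instance Definition _ := Lmodule_isNormed.Build R[i] (ell2 R)
  norm_triangle normZ norm_eq0.

Lemma ell2_normE x : `|x| = (ell2_norm x)%:C.
Proof. by []. Qed.

End ell2_norm.

Arguments ell2P {R} x.

Section ell2_complete.
Context {R : realType}.

Let ell2_cauchy_near (F : set_system (ell2 R)) (FF : Filter F) (e : R) :
  cauchy F -> 0 < e ->
  \forall x & y \near F, ell2_norm (x - y) < e.
Proof.
move=> /cauchy_ballP Fc e0.
have := Fc e%:C; rewrite ltcR => /(_ e0); apply: filterS => -[x y] /=.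
by rewrite -ball_normE /ball_/= ell2_normE ltcR.
Qed.

Let lipschitz_cvg (F : set_system (ell2 R)) (FF : ProperFilter F)
    (g : ell2 R -> R) : (forall x y, `|g x - g y| <= ell2_norm (x - y)) ->
  cauchy F -> cvg (g @ F).
Proof.
move=> gl Fc; apply: R_complete; apply/cauchy_ballP => e e0.
rewrite near_map2; apply: filterS (ell2_cauchy_near _ Fc e0) => -[x y] /= xy.
by rewrite -ball_normE /ball_/=; exact: le_lt_trans xy.
Qed.

Lemma normc_ge_Re (z : R[i]) : `|complex.Re z| <= normc z.
Proof. by case: z => a b /=; rewrite -sqrtr_sqr ler_wsqrtr// lerDl sqr_ge0. Qed.

Lemma normc_ge_Im (z : R[i]) : `|complex.Im z| <= normc z.
Proof. by case: z => a b /=; rewrite -sqrtr_sqr ler_wsqrtr// lerDr sqr_ge0. Qed.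

Let ell2_complete (F : set_system (ell2 R)) : ProperFilter F -> cauchy F -> cvg F.
Proof.
move=> FF Fc.
have cRe n : cvg ((fun x : ell2 R => complex.Re (x n)) @ F).
  apply: lipschitz_cvg => // x y; apply: le_trans (normc_le_ell2_norm (x - y) n).
  by rewrite -raddfB/=; exact: normc_ge_Re.
have cIm n : cvg ((fun x : ell2 R => complex.Im (x n)) @ F).
  apply: lipschitz_cvg => // x y; apply: le_trans (normc_le_ell2_norm (x - y) n).
  by rewrite -raddfB/=; exact: normc_ge_Im.
pose l n : R[i] := lim ((fun x : ell2 R => complex.Re (x n)) @ F) +i*
  lim ((fun x : ell2 R => complex.Im (x n)) @ F).
have tail (x : ell2 R) (e : R) : 0 <= e ->
    (\forall y \near F, ell2_norm (x - y) <= e) ->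
    forall N, series (fun n => normc (x n - l n) ^+ 2) N <= e ^+ 2.
  move=> e0 xe N.
  have cv : (\sum_(0 <= n < N) normc (x n - y n) ^+ 2) @[y --> F] -->
      \sum_(0 <= n < N) normc (x n - l n) ^+ 2.
    apply: cvg_big => [|n _]; first exact: add_continuous.
    under eq_fun do rewrite sqr_normcE.
    rewrite sqr_normcE; apply: cvgD.
      under eq_fun do rewrite raddfB.
      by rewrite raddfB; apply: cvgM; apply: cvgB; [exact: cvg_cst|exact: cRe|exact: cvg_cst|exact: cRe].
    under eq_fun do rewrite raddfB.
    by rewrite raddfB; apply: cvgM; apply: cvgB; [exact: cvg_cst|exact: cIm|exact: cvg_cst|exact: cIm].
  apply: (cvgr_to_le cv); apply: filterS xe => y xy.
  apply: le_trans (ell2_partial_le (x - y) N) _.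
  by rewrite -sqr_ell2_norm ler_pXn2r// nnegrE ell2_norm_ge0.
have tailF (e : R) : 0 < e -> F (fun x : ell2 R => forall N,
    series (fun n => normc (x n - l n) ^+ 2) N <= e ^+ 2).
  move=> e0; apply: filterS (nearP_dep (ell2_cauchy_near _ Fc e0)) => x xe; apply: tail; first exact: ltW.
  by apply: filterS xe => y /ltW.
have sl : square_summable l.
  have [x xl] := filter_ex (tailF 1 ltr01).
  have sxl : square_summable ((x : nat -> R[i]) - l) by exact: square_summable_le xl.
  have -> : l = (x : nat -> R[i]) + (-1) *: ((x : nat -> R[i]) - l).
    by rewrite scaleN1r opprB addrC subrK.
  by apply: square_summableD; [exact: ell2P|exact: square_summableZ].
have lP : l \in ell2_pred by exact/asboolP.
apply/cvg_ex; exists (Ell2 lP); apply/cvg_ballP => e.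
case: e => e i0; rewrite ltcE/= => /andP[/eqP-> e0].
have := tailF (e / 2) (divr_gt0 e0 (ltr0n _ 2)).
apply: filterS => x xe; rewrite -ball_normE /ball_/= distrC ell2_normE ltcR.
apply: (@le_lt_trans _ _ (e / 2)); last by rewrite gtr_pMr// invf_lt1// ltr1n.
by apply: ell2_norm_le => //; rewrite divr_ge0// ltW.
Qed.

HB.instance Definition _ := Uniform_isComplete.Build (ell2 R) ell2_complete.

End ell2_complete.

Section ell2_inner.
Context {R : realType}.
Implicit Types x y : ell2 R.

Definition ell2_inner x y : R[i] :=
  limn (series (fun n => x n * (y n)^* : R[i]^o)).

Let cvg_complex (u : nat -> R[i]^o) (a b : R) :
  (fun n => complex.Re (u n)) @ \oo --> a ->
  (fun n => complex.Im (u n)) @ \oo --> b -> u @ \oo --> (a +i* b : R[i]^o).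
Proof.
move=> ua ub; apply/cvgrPdist_lt => -[e i0].
rewrite ltcE/= => /andP[/eqP-> e0]; have e20 : 0 < e / 2 by rewrite divr_gt0.
move/cvgrPdist_lt : ua => /(_ _ e20) ua; move/cvgrPdist_lt : ub => /(_ _ e20) ub.
apply: filterS2 ua ub => n.
case: (u n) => c d /= ac bd; rewrite ltcR.
apply: (@le_lt_trans _ _ (`|a - c| + `|b - d|)); last first.
  by rewrite [ltRHS](splitr e) ltrD.
rewrite -(@ler_pXn2r _ 2)// ?nnegrE ?sqrtr_ge0 ?addr_ge0//.
rewrite sqr_sqrtr ?addr_ge0 ?sqr_ge0// [leRHS]sqrrD !real_normK ?num_real// [leRHS]addrAC.
by rewrite lerDl mulrn_wge0// mulr_ge0.
Qed.

Lemma cvg_ell2_inner x y :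
  cvgn (series (fun n => x n * (y n)^* : R[i]^o)).
Proof.
have sxy : cvgn (series (fun n => normc (x n) ^+ 2 + normc (y n) ^+ 2)).
  rewrite [X in series X](_ : _ = (fun n => normc (x n) ^+ 2) +
    (fun n => normc (y n) ^+ 2))//.
  by apply: is_cvg_seriesD; exact: ell2P.
have sle (f : R[i] -> R) : (forall z, `|f z| <= normc z) ->
    cvgn (series (fun n => f (x n * (y n)^*))).
  move=> fl; apply: normed_cvg; apply: series_le_cvg sxy => n.
  - exact: normr_ge0.
  - by rewrite addr_ge0// sqr_ge0.
  apply: (le_trans (fl _)); rewrite normcM.
  have -> : normc (y n)^* = normc (y n).
    by case: (y n) => a b /=; rewrite sqrrN.
  move: (normc_ge0 (x n)) (normc_ge0 (y n)).
  move: (normc (x n)) (normc (y n)) => a b a0 b0.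
  have := sqr_ge0 (a - b); rewrite sqrrB => ab.
  rewrite -subr_ge0 (_ : _ - _ = (a ^+ 2 - a * b *+ 2 + b ^+ 2) + a * b); last by ring.
  by rewrite addr_ge0// mulr_ge0.
have serE (f : {additive R[i] -> R}) (u : nat -> R[i]) :
    (fun n => f (series u n)) = series (fun n => f (u n)).
  by apply/funext => n; rewrite /series/= raddf_sum.
apply/cvg_ex; eexists; apply: cvg_complex.
  have := sle _ normc_ge_Re; rewrite -serE; exact.
have := sle _ normc_ge_Im; rewrite -serE; exact.
Qed.

Lemma ell2_innerxx x : ell2_inner x x = (ell2_norm x ^+ 2)%:C.
Proof.
rewrite sqr_ell2_norm /ell2_inner.
have -> : series (fun n => x n * (x n)^* : R[i]^o) =
    (fun n => (series (fun k => normc (x k) ^+ 2) n)%:C : R[i]^o).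
  apply/funext => n; rewrite /series/= rmorph_sum; apply: eq_bigr => k _.
  by rewrite -sqr_normc rmorphXn.
apply: (@cvg_lim R[i]^o); first exact: norm_hausdorff.
by apply: cvg_complex; [exact: ell2P|exact: cvg_cst].
Qed.

Definition adjoint_of (T S : ell2 R -> ell2 R) : Prop :=
  forall x y, ell2_inner (T x) y = ell2_inner x (S y).

(* S is the Hilbert adjoint of U, so this reads U^* U = U U^* = 1. *)
Definition unitary (U : {linear ell2 R -> ell2 R}) : Prop :=
  bounded_operator U /\
  exists S : {linear ell2 R -> ell2 R},
    [/\ bounded_operator S, adjoint_of U S, cancel U S & cancel S U].

End ell2_inner.

(* Main.v *)
(** Take [U] diagonal with entries [l n] on the unit circle and [F = <., b> a].
If [a n = weight n * (m n - l n)] and [<u_k, b> = 1], where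
[u_k n = a n / (m k - l n)], then [u_k] is an eigenvector of [T = U + F] for the
eigenvalue [m k], which is a root of unity. The pairs [(l n, m n)] are chosen
one after the other: [m n] very close to [m (parent n)], so that [u_n] is close
to [u_(parent n)], then [l n] much closer still to [m n].

The eigenvalues whose index lies in [2^g, 2^(g+1)) are (2^g w)-th roots of -1
with [w] odd, and the eigenvalues of smaller index are (2^g w)-th roots of 1
for suitable odd [w].  Hence a common power [T^N] fixes [u_i] and changes the
sign of [u_(i + 2^g)], for all [i < 2^g] simultaneously.  So
[z = \sum_i (c_i + d_i)/2 u_i + (c_i - d_i)/2 u_(i + 2^g)] is close to
[\sum_i c_i u_i], while [T^N z] is close to [\sum_i d_i u_i].  Since the [u_i]
span a dense subspace, [T] is topologically transitive, and a Baire category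
argument yields a hypercyclic vector. *)
From HB Require Import structures.
Require Import Defs.
From mathcomp Require Import all_boot all_order all_algebra.
From mathcomp Require Import complex ring lra.
From mathcomp Require Import all_classical all_reals all_analysis.
Set Implicit Arguments.
Unset Strict Implicit.
Unset Printing Implicit Defensive.
Import Order.TTheory GRing.Theory Num.Theory.
Import numFieldNormedType.Exports.
Import ComplexField.Normc.
Local Open Scope classical_set_scope.
Local Open Scope complex_scope.
Local Open Scope ring_scope.

(** * Modulus on [R[i]], neighborhoods, and roots of -1 on the unit circle *)

Section complex_modulus.
Context {R : realType}.
Implicit Types z w : R[i].

Lemma normc_eq0 z : (normc z == 0) = (z == 0).
Proof. by apply/eqP/eqP => [/eq0_normc//|->]; rewrite normc0. Qed.

Lemma normc_gt0 z : (0 < normc z) = (z != 0).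
Proof. by rewrite lt_def normc_ge0 andbT normc_eq0. Qed.

Lemma normc_real (a : R) : normc a%:C = `|a|.
Proof. by rewrite /= expr0n addr0 sqrtr_sqr. Qed.

Lemma normc_sum I (r : seq I) (P : pred I) (F : I -> R[i]) :
  normc (\sum_(i <- r | P i) F i) <= \sum_(i <- r | P i) normc (F i).
Proof.
elim/big_ind2 : _ => [|x1 x2 y1 y2 h1 h2|//]; first by rewrite normc0.
by apply: (le_trans (le_normcD _ _)); exact: lerD.
Qed.

Lemma near_normc_lt (T : Type) (F : set_system T) (FF : Filter F)
    (f : T -> R[i]^o) (c : R[i]^o) (e : R) :
  f @ F --> c -> normc c < e -> \forall z \near F, normc (f z) < e.
Proof.
move=> /cvgrPdist_lt cf fe.
have e0 : 0 < (e - normc c)%:C by rewrite ltcR subr_gt0.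
apply: filterS (cf _ e0) => z; rewrite -[`|_|]/((normc (c - f z))%:C) ltcR => h.
rewrite -(subKr c (f z)); apply: le_lt_trans (le_normcD _ _) _.
by rewrite normcN -ltrBrDl.
Qed.

Lemma near_forall_ltn (T : Type) (F : set_system T) (FF : Filter F) (N : nat)
    (P : nat -> T -> Prop) :
  (forall k, (k < N)%N -> \forall z \near F, P k z) ->
  \forall z \near F, forall k, (k < N)%N -> P k z.
Proof.
move=> h; have : \forall z \near F, forall k : 'I_N, P k z.
  by apply: filter_forall => k; exact: h.
by apply: filterS => z Pz k kN; exact: (Pz (Ordinal kN)).
Qed.

Lemma near_dnbhs_neq (c a : R[i]^o) : \forall z \near c^', z != a.
Proof.
have [->|ca] := eqVneq c a; first exact: nbhs_dnbhs_neq.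
apply: nbhs_dnbhs.
have e0 : 0 < (`|c - a|) by rewrite normr_gt0 subr_eq0.
have /cvgrPdist_lt/(_ _ e0) : (id z : R[i]^o) @[z --> c] --> c by exact: cvg_id.
by apply: filterS => z; apply: contraTneq => ->; rewrite ltxx.
Qed.

Lemma cvg_dnbhs_id (c : R[i]^o) : z @[z --> c^'] --> c.
Proof. by move=> P cP; exact: nbhs_dnbhs. Qed.

Definition cis (t : R) : R[i] := cos t +i* sin t.

Lemma cisD s t : cis (s + t) = cis s * cis t.
Proof. by rewrite /cis cosD sinD; simpc; congr (_ +i* _); rewrite addrC. Qed.

Lemma normc_cis t : normc (cis t) = 1.
Proof. by rewrite /cis /= cos2Dsin2 sqrtr1. Qed.

Lemma cisX t n : cis t ^+ n = cis (t *+ n).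
Proof.
elim: n => [|n IH]; first by rewrite /cis mulr0n cos0 sin0.
by rewrite exprS IH mulrS cisD.
Qed.

(** The point with argument [pi / (M * w)] has [(M * w)]-th power -1, and it tends to 1 as the odd
    number [w] grows. *)
Lemma root_of_minus_one_near1 (M : nat) (e : R) : (0 < M)%N -> 0 < e ->
  exists z : R[i], exists w : nat,
    [/\ normc z = 1, odd w, z ^+ (M * w) = - 1 & normc (1 - z) < e].
Proof.
move=> M0 e0.
(* The threshold for [1 - cos t] comes from [normc (1 - cis t) ^+ 2 = 2 * (1 - cos t)]. *)
have e20 : 0 < e ^+ 2 / 2 by rewrite divr_gt0 // exprn_gt0.
have /cvgrPdist_lt/(_ _ e20) := @continuous_cos R 0.
rewrite cos0 => /nbhs_ballP[d /= d0 dP].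
pose w := (2 * Num.truncn (pi / d)).+1.
have w0 : (0 < M * w)%N by rewrite muln_gt0 M0.
pose t : R := pi / (M * w)%:R.
exists (cis t), w; split.
- exact: normc_cis.
- by rewrite /w oddS oddM.
- rewrite cisX (_ : t *+ _ = pi) /cis ?cospi ?sinpi.
    by apply/eqP; rewrite eq_complex /= oppr0 !eqxx.
  by rewrite -[LHS]mulr_natr divfK// pnatr_eq0 gtn_eqF.
have td : t < d.
  rewrite ltr_pdivrMr ?ltr0n// mulrC -ltr_pdivrMr//.
  apply: (lt_le_trans (truncnS_gt _)); rewrite ler_nat.
  apply: leq_trans (leq_pmull _ M0).
  by rewrite ltnS leq_pmull.
have t0 : 0 < t by rewrite divr_gt0 ?pi_gt0 ?ltr0n.
have /dP : ball 0 d t by rewrite -ball_normE /ball_/= sub0r normrN gtr0_norm.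
move=> /(le_lt_trans (ler_norm _)) h.
rewrite -(@ltr_pXn2r _ 2)// ?nnegrE ?normc_ge0 ?(ltW e0)//.
rewrite sqr_normcE /cis /=.
have := cos2Dsin2 t; move: (cos t) (sin t) h => x y; nra.
Qed.

(** Rotation by [c] carries roots of -1 close to 1 to unimodular points close to [c]. *)
Lemma near_root_of_minus_one (M : nat) (c : R[i]^o) (P : set R[i]^o) :
  (0 < M)%N -> normc c = 1 -> (\forall z \near c^', P z) ->
  exists z : R[i], exists w : nat,
    [/\ normc z = 1, odd w, z ^+ (M * w) = - 1 & P (c * z)].
Proof.
move=> M0 c1 /nbhs_ballP[[e i0]] /=.
rewrite ltcE /= => /andP[/eqP-> e0] eP.
have [z [w [z1 ow zw ze]]] := root_of_minus_one_near1 M0 e0.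
exists z, w; split => //; apply: eP.
  rewrite -ball_normE /ball_/= -[`|_|]/((normc (c - c * z))%:C) ltcR.
  by rewrite -{1}(mulr1 c) -mulrBr normcM c1 mul1r.
(* The neighborhood is punctured: [c * z] differs from [c] because a power of [z] is -1, so that [z]
   is not 1. *)
rewrite -subr_eq0 -{2}(mulr1 c) -mulrBr mulf_neq0 //.
  by rewrite -normc_gt0 c1.
rewrite subr_eq0; apply/eqP => z1'; move/eqP: zw; rewrite z1' expr1n.
by rewrite -subr_eq0 opprK -(natrD _ 1 1) pnatr_eq0.
Qed.
End complex_modulus.

(** * Choice of the eigenvalues *)

(** Dependent choice with full history. Since [P N] only looks at the terms below [N], a finite
    history may be stored as a total function with arbitrary later values. *)
Lemma dependent_sequence (A : Type) (a0 : A) (P : nat -> (nat -> A) -> A -> Prop) :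
  (forall N s s' a, (forall k, (k < N)%N -> s k = s' k) -> P N s a -> P N s' a) ->
  (forall N s, (forall k, (k < N)%N -> P k s (s k)) -> exists a, P N s a) ->
  exists s, forall N, P N s (s N).
Proof.
move=> ext step.
have [f fP] : {f : nat * (nat -> A) -> A & forall Ns,
    (forall k, (k < Ns.1)%N -> P k Ns.2 (Ns.2 k)) -> P Ns.1 Ns.2 (f Ns)}.
  apply: (@choice _ _ (fun Ns a => (forall k, (k < Ns.1)%N -> P k Ns.2 (Ns.2 k)) ->
    P Ns.1 Ns.2 a)) => -[N s] /=.
  have [h|nh] := pselect (forall k, (k < N)%N -> P k s (s k)).
    by have [a Pa] := step N s h; exists a.
  by exists a0.
(* Only the first [N] values of [S N] are meaningful; the later ones repeat the last choice. The
   sequence sought is the diagonal [S k.+1 k]. *)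
pose S := fix S N : nat -> A :=
  if N is N'.+1 then fun k => if (k < N')%N then S N' k else f (N', S N')
  else fun=> a0.
pose s k := S k.+1 k.
have Ss N k : (k < N)%N -> S N k = s k.
  elim: N => // N IH kN1 /=; have [kN|Nk] := ltnP k N; first exact: IH.
  by have -> : k = N; [apply/eqP; rewrite eqn_leq Nk -ltnS kN1|rewrite /s /= ltnn].
exists s; elim/ltn_ind => N IH.
have -> : s N = f (N, S N) by rewrite /s /= ltnn.
apply: (ext _ _ _ _ (Ss N)); apply: (fP (N, S N)) => /= k kN.
by rewrite Ss//; apply: (ext k s); [move=> i ik; rewrite Ss// (ltn_trans ik)|exact: IH].
Qed.

Section construction.
Context {R : realType}.
Implicit Types l m : nat -> R[i].

Definition eps n : R := 2 ^- n.
Definition weight n : R := eps n ^+ 2.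
(** The fourth power leaves [eps n ^+ 2] after division by [weight n]; the factor 32 gives the 1/16
    of [near_basis_close] even when two tails add up. *)
Definition eta n : R := eps n ^+ 4 / 32.

Definition eigvec_seq l m k n : R[i] :=
  (weight n)%:C * ((m n - l n) / (m k - l n)).

(* Conjugate of the [n]-th coordinate of the vector [b_N], supported in [[0, N)],
   with [<u_k, b_N> = 1] for all [k < N]; the poles [l] and zeros [m] of the
   rational function in [partial_fractions] determine it. *)
Definition partial_dual l m N n : R[i] :=
  (weight n)^-1%:C * \prod_(k < N | k != n :> nat) ((l n - m k) / (l n - l k)).

Definition level N := trunc_log 2 N.
(** Deletes the leading binary digit of [N > 0]. Conversely, each [i < 2 ^ g] is the parent of
    [i + 2 ^ g], an index of level [g]. *)
Definition parent N := (N - 2 ^ level N)%N.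

(* [x] and [y] are admissible values of [l N] and [m N].  In terms of [u] and
   [b_N], the last four fields make [u_N - u_(parent N)] small on the
   coordinates below [N], the [N]-th coordinate of the previous [u_k] small, the
   new coordinate of [b_(N+1)] small, and [b_(N+1) - b_N] small on the
   coordinates below [N]. *)
Record next_point N l m (x y : R[i]) : Prop := NextPoint {
  next_l_unit : normc x = 1;
  next_m_unit : normc y = 1;
  next_base : N = 0%N -> y = 1;
  next_neq : x != y;
  next_fresh : forall k, (k < N)%N -> [/\ x != l k, y != l k & x != m k];
  next_root : (0 < N)%N -> exists2 w, odd w & y ^+ (2 ^ level N * w) = -1;
  next_close : (0 < N)%N -> forall k, (k < N)%N ->
    normc ((weight k)%:C * ((m k - l k) / (y - l k)) -
           (weight k)%:C * ((m k - l k) / (m (parent N) - l k))) <= eta N;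
  next_tail : forall k, (k < N)%N -> normc (y - x) <= eta N * normc (m k - x);
  next_small : (0 < N)%N ->
    normc (\prod_(k < N) ((x - m k) / (x - l k))) <= eta N;
  next_dual : forall n, (n < N)%N ->
    normc (partial_dual l m N n * ((y - x) / (l n - x))) <= eta N
}.

Lemma eps_gt0 n : 0 < eps n. Proof. by rewrite invr_gt0 exprn_gt0. Qed.

Lemma eta_gt0 n : 0 < eta n.
Proof. by rewrite divr_gt0// exprn_gt0// eps_gt0. Qed.

Lemma weight_gt0 n : 0 < weight n.
Proof. by rewrite exprn_gt0// eps_gt0. Qed.

Lemma parent_lt N : (0 < N)%N -> (parent N < N)%N.
Proof. by move=> N0; rewrite /parent ltn_subrL N0 expn_gt0. Qed.

Lemma next_point_ext N l m l' m' x y :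
  (forall k, (k < N)%N -> l k = l' k) -> (forall k, (k < N)%N -> m k = m' k) ->
  next_point N l m x y -> next_point N l' m' x y.
Proof.
move=> el em [h1 h2 h0 h3 h4 h5 h6 h7 h8 h9]; split => //.
- by move=> k kN; rewrite -el// -em//; exact: h4.
- by move=> N0 k kN; rewrite -el// -!em ?parent_lt//; exact: h6.
- by move=> k kN; rewrite -em//; exact: h7.
- move=> N0; rewrite (eq_bigr (fun k : 'I_N => (x - m k) / (x - l k))); first exact: h8.
  by move=> k _; rewrite el ?em.
- move=> n nN; rewrite /partial_dual.
  rewrite (eq_bigr (fun k : 'I_N => (l n - m k) / (l n - l k))) -?el//; first exact: h9.
  by move=> k _; rewrite -!el ?em.
Qed.

(** For [0 < i < 2 ^ g] the level of [i] is below [g], so [2 ^ g * w] is an even multiple of an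
    exponent that sends [m i] to -1. For [i = 0] the eigenvalue is 1. *)
Lemma level_root l m N i :
  (forall k, (k < N)%N -> next_point k l m (l k) (m k)) -> m 0%N = 1 ->
  (i < N)%N -> forall g, (i < 2 ^ g)%N -> exists2 w, odd w & m i ^+ (2 ^ g * w) = 1.
Proof.
move=> h m0 iN g ig; have [->|i0] := posnP i.
  by exists 1%N => //; rewrite m0 expr1n.
have [w ow mw] := next_root (h i iN) i0.
exists w => //.
have lg : (level i < g)%N.
  rewrite -(@ltn_exp2l 2)//; apply: leq_ltn_trans ig; exact: trunc_logP.
have -> : (2 ^ g * w = 2 ^ level i * w * (2 * 2 ^ (g - (level i).+1)))%N.
  by rewrite -{1}(subnK lg) expnD expnS; ring.
by rewrite exprM mw exprM sqrrN !expr1n.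
Qed.

Section punctured_neighborhood.
Context (F : set_system R[i]^o) {FF : Filter F} (c : R[i]^o).
Hypothesis Fc : z @[z --> F] --> c.
Hypothesis Fneq : forall a, \forall z \near F, z != a.

Let cvg_sub_r (a : R[i]) : (z - a : R[i]^o) @[z --> F] --> (c - a : R[i]^o).
Proof. by apply: cvgB; [exact: Fc|exact: cvg_cst]. Qed.

Let cvg_sub_l (a : R[i]) : (a - z : R[i]^o) @[z --> F] --> (a - c : R[i]^o).
Proof. by apply: cvgB; [exact: cvg_cst|exact: Fc]. Qed.

Lemma near_prod_ratio_lt l m (N : nat) (e : R) :
  (forall k, (k < N)%N -> c != l k) ->
  normc (\prod_(k < N) ((c - m k) / (c - l k))) < e ->
  \forall z \near F, normc (\prod_(k < N) ((z - m k) / (z - l k))) < e.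
Proof.
move=> cl; apply: near_normc_lt.
apply: (@cvg_big R[i]^o _ *%R 1) => [|k _]; first exact: mul_continuous.
apply: cvgM; first exact: cvg_sub_r.
by apply: cvgV; [rewrite subr_eq0; exact: cl|exact: cvg_sub_r].
Qed.

(** At [y = m p] the differences vanish and the product has the zero factor [k = p], so the strict
    bounds persist nearby by continuity. The filter itself avoids the finitely many forbidden
    values. *)
Lemma near_next_m N l m p : c = m p -> (p < N)%N ->
  (forall k, (k < N)%N -> c != l k) ->
  \forall y \near F, [/\ forall k, (k < N)%N -> y != l k,
    forall k, (k < N)%N -> y != m k,
    forall k, (k < N)%N -> normc ((weight k)%:C * ((m k - l k) / (y - l k)) -
           (weight k)%:C * ((m k - l k) / (m p - l k))) < eta N &
    normc (\prod_(k < N) ((y - m k) / (y - l k))) < eta N].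
Proof.
move=> cp pN cl.
have n1 : \forall y \near F, forall k, (k < N)%N -> y != l k.
  exact: near_forall_ltn.
have n2 : \forall y \near F, forall k, (k < N)%N -> y != m k.
  exact: near_forall_ltn.
have n3 : \forall y \near F, forall k, (k < N)%N ->
    normc ((weight k)%:C * ((m k - l k) / (y - l k)) -
           (weight k)%:C * ((m k - l k) / (m p - l k))) < eta N.
  apply: near_forall_ltn => k kN.
  apply: (@near_normc_lt _ _ _ _ _ (((weight k)%:C * ((m k - l k) / (c - l k)) -
           (weight k)%:C * ((m k - l k) / (m p - l k))) : R[i]^o)); last first.
    by rewrite cp subrr normc0 eta_gt0.
  apply: cvgB; last exact: cvg_cst.
  apply: cvgM; first exact: cvg_cst.
  apply: cvgM; first exact: cvg_cst.
  by apply: cvgV; [rewrite subr_eq0; exact: cl|exact: cvg_sub_r].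
have n4 : \forall y \near F,
    normc (\prod_(k < N) ((y - m k) / (y - l k))) < eta N.
  apply: near_prod_ratio_lt; first by move=> k kN; exact: cl.
  by rewrite (bigD1 (Ordinal pN))//= cp subrr !mul0r normc0 eta_gt0.
by near=> y; split; near: y.
Unshelve. all: by end_near. Qed.

(** As [x] tends to [c], the factor [c - x] tends to 0 while the denominators keep nonzero limits.
    The product bound, already secured at [c], is an open condition. *)
Lemma near_next_l N l m :
  (forall k, (k < N)%N -> c != l k) -> (forall k, (k < N)%N -> c != m k) ->
  normc (\prod_(k < N) ((c - m k) / (c - l k))) < eta N ->
  \forall x \near F, [/\ x != c,
    forall k, (k < N)%N -> x != l k,
    forall k, (k < N)%N -> x != m k,
    forall k, (k < N)%N -> normc (c - x) <= eta N * normc (m k - x) &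
    normc (\prod_(k < N) ((x - m k) / (x - l k))) < eta N /\
    forall k, (k < N)%N ->
      normc (partial_dual l m N k * ((c - x) / (l k - x))) < eta N].
Proof.
move=> cl cm cprod.
have n0 : \forall x \near F, x != c by [].
have n1 : \forall x \near F, forall k, (k < N)%N -> x != l k.
  exact: near_forall_ltn.
have n2 : \forall x \near F, forall k, (k < N)%N -> x != m k.
  exact: near_forall_ltn.
have n3 : \forall x \near F, forall k, (k < N)%N ->
    normc (c - x) <= eta N * normc (m k - x).
  apply: near_forall_ltn => k kN.
  have : \forall x \near F, normc ((c - x) / (m k - x)) < eta N.
    apply: (@near_normc_lt _ _ _ _ _ ((c - c) / (m k - c) : R[i]^o)); last first.
      by rewrite subrr mul0r normc0 eta_gt0.
    apply: cvgM; first exact: cvg_sub_l.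
    by apply: cvgV; [rewrite subr_eq0 eq_sym; exact: cm|exact: cvg_sub_l].
  apply: filterS2 (Fneq (m k)) => x xm.
  rewrite normcM normcV => /ltW; rewrite ler_pdivrMr// normc_gt0 subr_eq0 eq_sym.
  exact: xm.
have n4 : \forall x \near F,
    normc (\prod_(k < N) ((x - m k) / (x - l k))) < eta N.
  exact: near_prod_ratio_lt.
have n5 : \forall x \near F, forall k, (k < N)%N ->
    normc (partial_dual l m N k * ((c - x) / (l k - x))) < eta N.
  apply: near_forall_ltn => k kN.
  apply: (@near_normc_lt _ _ _ _ _
    (partial_dual l m N k * ((c - c) / (l k - c)) : R[i]^o)); last first.
    by rewrite subrr mul0r mulr0 normc0 eta_gt0.
  apply: cvgM; first exact: cvg_cst.
  apply: cvgM; first exact: cvg_sub_l.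
  by apply: cvgV; [rewrite subr_eq0 eq_sym; exact: cl|exact: cvg_sub_l].
by near=> x; split; [near: x..|split; near: x].
Unshelve. all: by end_near. Qed.
End punctured_neighborhood.

Lemma next_point_exists N l m :
  (forall k, (k < N)%N -> next_point k l m (l k) (m k)) ->
  exists x y, next_point N l m x y.
Proof.
move=> h; case: N => [|n] in h *.
  exists (-1), 1; split => //.
  - by rewrite normcN normc1.
  - exact: normc1.
  - by rewrite eq_sym -subr_eq0 opprK -(natrD _ 1 1) pnatr_eq0.
set N := n.+1 in h *; have N0 : (0 < N)%N by [].
set p := parent N; have pN : (p < N)%N by exact: parent_lt.
have lm i k : (i < N)%N -> (k < N)%N -> m i != l k.
  move=> iN kN; case: (ltngtP i k) => [ik|ki|->].
  - by rewrite eq_sym; case: (next_fresh (h k kN) ik).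
  - by case: (next_fresh (h i iN) ki).
  - by rewrite eq_sym; exact: (next_neq (h k kN)).
(* The parent satisfies [p < 2 ^ level N], so its eigenvalue is a root of unity whose order has
   2-part dividing [2 ^ level N]. *)
have [w0 ow0 mw0] : exists2 w, odd w & m p ^+ (2 ^ level N * w) = 1.
  apply: (level_root h) => //.
    exact: (next_base (h 0%N _)).
  by rewrite /p /parent ltn_subLR ?trunc_logP// addnn -mul2n -expnS trunc_log_ltn.
have nearY := near_next_m (m := m) (p := p)
  (@cvg_dnbhs_id R (m p)) (@near_dnbhs_neq R (m p))
  (erefl (m p)) pN (fun k kN => lm p k pN kN).
have M0 : (0 < 2 ^ level N)%N by rewrite expn_gt0.
have [z [w [z1 ow zw [y1 y2 y3 y4]]]] :=
  near_root_of_minus_one M0 (next_m_unit (h p pN)) (nearY _).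
set y := m p * z in y1 y2 y3 y4.
have yu : normc y = 1 by rewrite normcM z1 (next_m_unit (h p pN)) mul1r.
have nearX := near_next_l (m := m) (@cvg_dnbhs_id R y) (@near_dnbhs_neq R y) y1 y2 y4.
(* With [M = 1] the same lemma supplies a unimodular [x = y * z'] as close to [y] as desired. *)
have [z' [w' [z'1 _ _ [x0 x1 x2 x3 [x4 x5]]]]] :=
  near_root_of_minus_one (ltn0Sn 0) yu (nearX _).
exists (y * z'), y; split => //.
- by rewrite normcM yu z'1 mul1r.
- by move=> k kN; split; [exact: x1|exact: y1|exact: x2].
(* Raising [m p] to this exponent gives 1, and raising [z] gives [(-1) ^+ w0 = -1] because [w0] is
   odd. *)
- move=> _; exists (w0 * w)%N; first by rewrite oddM ow0.
  rewrite exprMn mulnA exprM mw0 expr1n mul1r mulnAC exprM zw.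
  by rewrite -signr_odd ow0.
- by move=> _ k kN; exact/ltW/y3.
- by move=> _; exact: ltW.
- by move=> k kN; exact/ltW/x5.
Unshelve. all: by end_near. Qed.

Section next_point_theory.
Variables (l m : nat -> R[i]).
Hypothesis lmP : forall N, next_point N l m (l N) (m N).

Lemma next_m_neq_l i k : m i != l k.
Proof.
case: (ltngtP i k) => [ik|ki|->].
- by rewrite eq_sym; case: (next_fresh (lmP k) ik).
- by case: (next_fresh (lmP i) ki).
- by rewrite eq_sym; exact: (next_neq (lmP k)).
Qed.

Lemma next_l_neq i k : i != k -> l i != l k.
Proof.
rewrite neq_ltn => /orP[ik|ki]; last by case: (next_fresh (lmP i) ki).
by rewrite eq_sym; case: (next_fresh (lmP k) ik).
Qed.

Lemma partial_dualS N n : (n < N)%N -> partial_dual l m N.+1 n =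
  partial_dual l m N n * ((l n - m N) / (l n - l N)).
Proof.
move=> nN; rewrite /partial_dual -mulrA; congr (_ * _).
rewrite big_mkcond big_ord_recr /= -big_mkcond /=.
by rewrite eq_sym ltn_eqF//.
Qed.

Lemma partial_dual_new N : partial_dual l m N.+1 N =
  (weight N)^-1%:C * \prod_(k < N) ((l N - m k) / (l N - l k)).
Proof.
rewrite /partial_dual; congr (_ * _).
rewrite big_mkcond big_ord_recr /= eqxx mulr1.
by apply: eq_bigr => k _; rewrite ltn_eqF.
Qed.

(** Partial fraction expansion of a rational function with value 1 at infinity and simple poles
    [l n]. In the induction, the residue at the new pole [l N] comes from the induction hypothesis
    taken at [l N]. *)
Lemma partial_fractions N z : (forall k, (k < N)%N -> z != l k) ->
  \prod_(k < N) ((z - m k) / (z - l k)) =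
  1 - \sum_(n < N) (weight n)%:C * (m n - l n) * partial_dual l m N n / (z - l n).
Proof.
elim: N z => [|N IH] z zl; first by rewrite !big_ord0 subr0.
have zN := zl N (ltnSn N).
have zk k : (k < N)%N -> z != l k by move=> kN; apply: zl; exact: ltnW.
have lk k : (k < N)%N -> l N != l k by move=> kN; rewrite next_l_neq// gtn_eqF.
rewrite big_ord_recr /= (IH _ zk) big_ord_recr /= partial_dual_new (IH _ lk).
have w0 : (weight N)%:C != 0 :> R[i] by rewrite gt_eqF// ltcR weight_gt0.
have -> : (weight N)^-1%:C = (weight N)%:C^-1 :> R[i] by rewrite fmorphV.
(* Each old residue acquires the factor [(l i - m N) / (l i - l N)]; dividing it by [z - l i] and
   splitting off the pole [l N] gives the two sums. *)
have -> : \sum_(i < N) (weight i)%:C * (m i - l i) * partial_dual l m N.+1 i / (z - l i) =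
    \sum_(i < N) (weight i)%:C * (m i - l i) * partial_dual l m N i / (z - l i) *
       ((z - m N) / (z - l N)) -
    (l N - m N) / (z - l N) *
    \sum_(i < N) (weight i)%:C * (m i - l i) * partial_dual l m N i / (l N - l i).
  rewrite mulr_sumr -sumrB; apply: eq_bigr => i _; rewrite partial_dualS//.
  field; rewrite !subr_eq0 zN zk//= lk//= next_l_neq// ltn_eqF//.
rewrite -mulr_suml; set S := \sum_(i < N) _; set S' := \sum_(i < N) _.
by field; rewrite subr_eq0 zN w0.
Qed.

(** The expansion is evaluated at the zero [z = m k] of the product. *)
Lemma sum_eigvec_dual N k : (k < N)%N ->
  \sum_(n < N) eigvec_seq l m k n * partial_dual l m N n = 1.
Proof.
move=> kN; have := @partial_fractions N (m k) (fun i _ => next_m_neq_l k i).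
rewrite (bigD1 (Ordinal kN))//= subrr !mul0r => /esym/eqP; rewrite subr_eq0 => /eqP ->.
by apply: eq_bigr => i _; rewrite /eigvec_seq; ring.
Qed.
End next_point_theory.

Lemma sequences_exist : exists l m : nat -> R[i],
  forall N, next_point N l m (l N) (m N).
Proof.
have [||s sP] := @dependent_sequence (R[i] * R[i])%type (0, 0) (fun N s a =>
    next_point N (fun k => (s k).1) (fun k => (s k).2) a.1 a.2).
- move=> N s s' a ss'; by apply: next_point_ext => k kN; rewrite ss'.
- move=> N s h; have [x [y xy]] := next_point_exists h.
  by exists (x, y).
by exists (fun k => (s k).1), (fun k => (s k).2).
Qed.
End construction.

(** * Estimates and operators in the sequence space *)

Section ell2_estimates.
Context {R : realType}.
Implicit Types x y z : ell2 R.

Lemma ell2_sumE I (r : seq I) (P : pred I) (F : I -> ell2 R) n :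
  (\sum_(i <- r | P i) F i) n = \sum_(i <- r | P i) F i n.
Proof. by elim/big_ind2 : _ => // x a y b <- <-. Qed.

Lemma ell2_normN x : ell2_norm (- x) = ell2_norm x.
Proof. by rewrite -scaleN1r ell2_normZ normcN normc1 mul1r. Qed.

Lemma ell2_norm_distC x y : ell2_norm (x - y) = ell2_norm (y - x).
Proof. by rewrite -opprB ell2_normN. Qed.

Lemma ell2_norm0 : ell2_norm (0 : ell2 R) = 0.
Proof. by rewrite -(scale0r (0 : ell2 R)) ell2_normZ normc0 mul0r. Qed.

Lemma ell2_norm_sum I (r : seq I) (P : pred I) (F : I -> ell2 R) :
  ell2_norm (\sum_(i <- r | P i) F i) <= \sum_(i <- r | P i) ell2_norm (F i).
Proof.
elim/big_ind2 : _ => [|x1 x2 y1 y2 h1 h2|//]; first by rewrite ell2_norm0.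
by apply: (le_trans (ler_ell2_normD _ _)); exact: lerD.
Qed.

Lemma epsS n : eps n.+1 = eps n / 2 :> R.
Proof. by rewrite /eps exprSr invfM. Qed.

Lemma sum_eps n : \sum_(k < n) eps k = 2 - 2 * eps n :> R.
Proof.
elim: n => [|n IH]; first by rewrite big_ord0 /eps expr0 invr1 mulr1 subrr.
by rewrite big_ord_recr /= IH epsS; field.
Qed.

Lemma geometric_partial_le (u : nat -> R[i]) M : 0 <= M ->
  (forall n, normc (u n) <= M * eps n) ->
  forall N, series (fun n => normc (u n) ^+ 2) N <= (2 * M) ^+ 2.
Proof.
(* The invariant [2 - 2 * 4 ^- N] grows by at least [4 ^- N] at each step, which makes the induction
   linear. *)
move=> M0 uM N; apply: (@le_trans _ _ (M ^+ 2 * (2 - 2 * eps N ^+ 2))); last first.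
  rewrite exprMn; move: (sqr_ge0 M) (mulr_ge0 (sqr_ge0 M) (sqr_ge0 (eps N))).
  by move: (M ^+ 2) (eps N ^+ 2) => a b; lra.
rewrite /series /=; elim: N => [|N IH].
  by rewrite big_geq// /eps expr0 invr1 mulr_ge0 ?sqr_ge0//; lra.
rewrite big_nat_recr//= epsS.
have : normc (u N) ^+ 2 <= (M * eps N) ^+ 2.
  by rewrite ler_pXn2r// nnegrE ?normc_ge0// mulr_ge0// ltW// eps_gt0.
move: IH; set s := \sum_(_ <= _ < _) _; rewrite exprMn expr_div_n.
have : 0 <= M ^+ 2 * eps N ^+ 2 by rewrite mulr_ge0 ?sqr_ge0.
by set a := M ^+ 2; set b := eps N ^+ 2; set c := normc _ ^+ 2 => *; lra.
Qed.

Lemma geometric_square_summable (u : nat -> R[i]) M : 0 <= M ->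
  (forall n, normc (u n) <= M * eps n) -> square_summable u.
Proof.
move=> M0 uM; apply: (@square_summable_le _ _ ((2 * M) ^+ 2)).
exact: geometric_partial_le.
Qed.

Lemma geometric_ell2_norm x M : 0 <= M ->
  (forall n, normc (x n) <= M * eps n) -> ell2_norm x <= 2 * M.
Proof.
move=> M0 xM; apply: ell2_norm_le; first by rewrite mulr_ge0.
exact: geometric_partial_le.
Qed.

Definition ell2_of (u : nat -> R[i]) (su : square_summable u) : ell2 R :=
  @Ell2 R u (asboolT su).

(** The tail of [x] is specified by its coordinates, so that a vector obtained otherwise can be
    recognized as that tail. *)
Lemma ell2_tail x e : 0 < e -> exists K, forall y,
  (forall n, (n < K)%N -> y n = 0) -> (forall n, (K <= n)%N -> y n = x n) ->
  ell2_norm y <= e.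
Proof.
move=> e0; have := ell2P x; rewrite /square_summable => cx.
have e20 : 0 < e ^+ 2 by rewrite exprn_gt0.
have /cvgrPdist_lt/(_ _ e20)[K _ KP] := cx.
exists K => y y0 yx; apply: ell2_norm_le => [|N]; first exact: ltW.
have [NK|KN] := leqP N K.
  rewrite /series /= big_nat_cond big1 ?sqr_ge0// => n /andP[/andP[_ nN] _].
  by rewrite y0 ?(leq_trans nN)// normc0 expr0n.
have := KP K (leqnn K); rewrite ger0_norm ?subr_ge0 ?ell2_partial_le//.
move=> /ltW; apply: le_trans; rewrite lerBrDl.
apply: le_trans (ell2_partial_le x N); rewrite /series /=.
rewrite [leRHS](big_cat_nat (n := K)) ?(ltnW KN)//= lerD2l.
rewrite (big_cat_nat (n := K)) ?(ltnW KN)//= big_nat_cond big1 ?add0r.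
  rewrite big_nat_cond [leRHS]big_nat_cond; apply: ler_sum => n.
  by move=> /andP[/andP[Kn _] _]; rewrite yx.
by move=> n /andP[/andP[_ nK] _]; rewrite y0// normc0 expr0n.
Qed.

Lemma ell2_near_lim (x : nat -> ell2 R) l : x @ \oo --> l ->
  forall e, 0 < e -> exists N, forall n, (N <= n)%N -> ell2_norm (l - x n) < e.
Proof.
move=> /cvgrPdist_lt xl e e0; have e0' : 0 < e%:C by rewrite ltcR.
have [N _ NP] := xl _ e0'; exists N => n Nn.
by have := NP n Nn; rewrite /= ell2_normE ltcR.
Qed.

Lemma eps_lt e : 0 < e -> exists N, eps N < e :> R.
Proof.
move=> e0; exists (Num.truncn e^-1).+1; rewrite /eps invf_plt ?posrE ?exprn_gt0//.
apply: (lt_trans (truncnS_gt _)).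
by rewrite -natrX ltr_nat ltn_expl.
Qed.

(** The increments from [n] to [n + k] sum to at most [2 * M * (eps n - eps (n + k))]; completeness
    gives the limit, which inherits the bound. *)
Lemma geometric_cauchy_cvg (x : nat -> ell2 R) M : 0 <= M ->
  (forall n, ell2_norm (x n.+1 - x n) <= M * eps n) ->
  exists l, forall n, ell2_norm (l - x n) <= 2 * M * eps n.
Proof.
move=> M0 xM.
have tail n k : ell2_norm (x (n + k)%N - x n) <= 2 * M * (eps n - eps (n + k)).
  elim: k => [|k IH]; first by rewrite addn0 !subrr mulr0 ell2_norm0.
  rewrite addnS -(subrKA (x (n + k)%N)); apply: (le_trans (ler_ell2_normD _ _)).
  by apply: (le_trans (lerD (xM _) IH)); rewrite epsS; lra.
have tail' n k : ell2_norm (x (n + k)%N - x n) <= 2 * M * eps n.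
  apply: (le_trans (tail n k)); rewrite ler_wpM2l ?mulr_ge0// gerBl.
  exact/ltW/eps_gt0.
have : cvg (x @ \oo).
  apply: cauchy_cvg; apply/cauchy_ballP => e.
  case: e => e i0; rewrite ltcE/= => /andP[/eqP-> e0].
  have [N NP] : exists N, 2 * M * eps N < e / 2.
    have MM : 0 < 2 * M + 1 by rewrite ltr_wpDl ?mulr_ge0.
    have [N Ne] := @eps_lt (e / 2 / (2 * M + 1)) (divr_gt0 (divr_gt0 e0 (ltr0Sn _ 1)) MM).
    exists N; move: Ne; rewrite ltr_pdivlMr// mulrC; apply: le_lt_trans.
    by rewrite ler_wpM2r ?lerDl// ltW// eps_gt0.
  rewrite near_map2; exists ([set k | (N <= k)%N], [set k | (N <= k)%N]) => /=.
    by split; exists N.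
  move=> [i j] /= [Ni Nj]; rewrite -ball_normE /ball_/= ell2_normE ltcR.
  rewrite -(subrKA (x N)); apply: (le_lt_trans (ler_ell2_normD _ _)).
  rewrite (ell2_norm_distC (x N)) -(subnKC Ni) -(subnKC Nj) (splitr e) ltrD//;
  exact: le_lt_trans (tail' _ _) _.
move=> /cvg_ex[l /= xl]; exists l => n; apply/ler_addgt0Pr => e e0.
have [N NP] := ell2_near_lim xl e0.
have := NP (maxn n N) (leq_maxr _ _) => h.
rewrite -(subrKA (x (maxn n N))); apply: (le_trans (ler_ell2_normD _ _)).
rewrite addrC lerD// ?(ltW h)//.
by rewrite -(subnKC (leq_maxl n N)).
Qed.

Section inner.
Implicit Types a b : ell2 R.

Lemma normc_conj (c : R[i]) : normc c^* = normc c.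
Proof. by case: c => a b /=; rewrite sqrrN. Qed.

Lemma ell2_inner_near x y e : 0 < e -> exists N0, forall N, (N0 <= N)%N ->
  normc (ell2_inner x y - \sum_(n < N) x n * (y n)^*) < e.
Proof.
move=> e0; have e0' : 0 < e%:C by rewrite ltcR.
have /cvgrPdist_lt/(_ _ e0')[N0 _ NP] := @cvg_ell2_inner _ x y.
exists N0 => N N0N; have := NP N N0N.
by rewrite /series /= big_mkord -[`|_|]/((normc (_ - _))%:C) ltcR.
Qed.

Lemma ell2_inner_linear y : linear (fun x => ell2_inner x y).
Proof.
move=> c x z; apply: (@cvg_lim R[i]^o); first exact: norm_hausdorff.
rewrite (_ : series _ = (fun n => c * series (fun n => x n * (y n)^*) n +
    series (fun n => z n * (y n)^*) n : R[i]^o)); last first.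
  apply/funext => n; rewrite /series /= mulr_sumr -big_split /=.
  by apply: eq_bigr => k _; rewrite -[LHS]/((c * x k + z k) * (y k)^*) mulrDl mulrA.
apply: cvgD; last exact: cvg_ell2_inner.
by apply: cvgM; [exact: cvg_cst|exact: cvg_ell2_inner].
Qed.

(** Cauchy-Schwarz: with [A], [B] the two norms, each term is at most [B / A / 2] times one square
    plus [A / B / 2] times the other, and these bounds sum to at most [A * B]. Zero norms are
    treated first because of the divisions. *)
Lemma normc_ell2_inner_le x y : normc (ell2_inner x y) <= ell2_norm x * ell2_norm y.
Proof.
have [/eqP/ell2_norm_eq0->|x0] := boolP (ell2_norm x == 0).
  rewrite ell2_norm0 mul0r.
  apply/ler_addgt0Pr => e e0; rewrite add0r.
  have [N0 /(_ N0 (leqnn _))] := ell2_inner_near 0 y e0.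
  by rewrite big1 ?subr0 => [/ltW//|n _]; rewrite mul0r.
have [/eqP/ell2_norm_eq0->|y0] := boolP (ell2_norm y == 0).
  rewrite ell2_norm0 mulr0.
  apply/ler_addgt0Pr => e e0; rewrite add0r.
  have [N0 /(_ N0 (leqnn _))] := ell2_inner_near x 0 e0.
  rewrite big1 ?subr0 => [/ltW//|n _].
  by rewrite -[LHS]/(x n * (0 : R[i])^*) rmorph0 mulr0.
have X0 : 0 < ell2_norm x by rewrite lt_neqAle eq_sym x0 ell2_norm_ge0.
have Y0 : 0 < ell2_norm y by rewrite lt_neqAle eq_sym y0 ell2_norm_ge0.
set A := ell2_norm x in x0 X0 *; set B := ell2_norm y in y0 Y0 *.
apply/ler_addgt0Pr => e e0.
have [N /(_ N (leqnn _)) NP] := ell2_inner_near x y e0.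
rewrite -(subrK (\sum_(n < N) x n * (y n)^*) (ell2_inner x y)) addrC.
apply: (le_trans (le_normcD _ _)); apply: lerD (ltW NP).
apply: (le_trans (normc_sum _ _ _)).
apply: (@le_trans _ _ (\sum_(n < N)
    (B / A / 2 * normc (x n) ^+ 2 + A / B / 2 * normc (y n) ^+ 2))).
  apply: ler_sum => n _; rewrite normcM normc_conj.
  move: (normc (x n)) (normc (y n)) => a b; rewrite -subr_ge0.
  rewrite [leRHS](_ : _ = (B * a - A * b) ^+ 2 / (2 * A * B)).
    by rewrite divr_ge0 ?sqr_ge0// !mulr_ge0// ltW.
  by field; rewrite x0 y0.
rewrite big_split/= -!mulr_sumr.
rewrite [leRHS](_ : _ = B / A / 2 * A ^+ 2 + A / B / 2 * B ^+ 2); last first.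
  by field; rewrite x0 y0.
have hx := ell2_partial_le x N; have hy := ell2_partial_le y N.
rewrite /series /= !big_mkord -!sqr_ell2_norm in hx hy.
by apply: lerD; apply: ler_wpM2l; rewrite ?divr_ge0 ?(ltW X0) ?(ltW Y0).
Qed.

End inner.

End ell2_estimates.

Section ell2_operators.
Context {R : realType}.
Implicit Types x y : ell2 R.

Lemma diag_op_summable (d : nat -> R[i]) x : (forall n, normc (d n) = 1) ->
  square_summable (fun n => d n * x n).
Proof.
move=> d1; rewrite /square_summable.
under eq_fun do rewrite normcM d1 mul1r.
exact: ell2P.
Qed.

Definition diag_op (d : nat -> R[i]) (d1 : forall n, normc (d n) = 1) x : ell2 R :=
  ell2_of (@diag_op_summable d x d1).

Lemma diag_op_is_linear d d1 : linear (@diag_op d d1).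
Proof.
move=> c x y; apply/val_inj/funext => n.
by rewrite -[LHS]/(d n * (c * x n + y n)) mulrDr mulrCA.
Qed.

HB.instance Definition _ d d1 :=
  GRing.isLinear.Build R[i] (ell2 R) (ell2 R) *:%R (@diag_op d d1)
    (diag_op_is_linear d1).

Lemma ell2_norm_diag_op d d1 x : ell2_norm (@diag_op d d1 x) = ell2_norm x.
Proof.
rewrite /ell2_norm /=; congr (Num.sqrt (limn (series _))); apply/funext => n.
by rewrite normcM d1 mul1r.
Qed.

Lemma diag_op_bounded d d1 : bounded_operator (@diag_op d d1).
Proof. by exists 1 => x; rewrite mul1r !ell2_normE ell2_norm_diag_op. Qed.

Lemma diag_op_unitary d d1 : unitary (@diag_op d d1).
Proof.
split; first exact: diag_op_bounded.
have d1' n : normc (d n)^* = 1 by rewrite normc_conj.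
have dd n : d n * (d n)^* = 1.
  have -> : d n * (d n)^* = `|d n| ^+ 2 by rewrite normCK.
  by rewrite -[`|d n|]/((normc (d n))%:C) d1 expr1n.
exists (diag_op d1'); split; first exact: diag_op_bounded.
- move=> x y; rewrite /ell2_inner.
  suff -> : (fun n => diag_op d1 x n * (y n)^* : R[i]^o) =
    (fun n => x n * (diag_op d1' y n)^*) by [].
  apply/funext => n.
  rewrite -[RHS]/(x n * ((d n)^* * y n)^*) -[LHS]/(d n * x n * (y n)^*).
  by rewrite rmorphM /= conjCK mulrCA mulrA.
- move=> x; apply/val_inj/funext => n /=.
  by rewrite mulrA (mulrC _ (d n)) dd mul1r.
- by move=> x; apply/val_inj/funext => n /=; rewrite mulrA dd mul1r.
Qed.

Definition rank_one_map (b a : ell2 R) x : ell2 R := ell2_inner x b *: a.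

Lemma rank_one_map_is_linear b a : linear (rank_one_map b a).
Proof.
by move=> c x y; rewrite /rank_one_map ell2_inner_linear scalerDl scalerA.
Qed.

HB.instance Definition _ b a :=
  GRing.isLinear.Build R[i] (ell2 R) (ell2 R) *:%R (rank_one_map b a)
    (rank_one_map_is_linear b a).

Lemma ell2_norm_rank_one_map b a x :
  ell2_norm (rank_one_map b a x) <= ell2_norm b * ell2_norm a * ell2_norm x.
Proof.
rewrite ell2_normZ mulrAC ler_wpM2r ?ell2_norm_ge0// mulrC.
exact: normc_ell2_inner_le.
Qed.

Lemma rank_one_map_bounded b a : bounded_operator (rank_one_map b a).
Proof.
exists (ell2_norm b * ell2_norm a)%:C => x.
by rewrite !ell2_normE -rmorphM lecR ell2_norm_rank_one_map.
Qed.

Lemma rank_one_mapP b a x : ell2_inner x b = 1 -> a != 0 ->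
  rank_one (rank_one_map b a).
Proof.
move=> xb a0; exists a => //; apply/seteqP; split => _ [y _ <-].
  by exists (ell2_inner y b).
exists (y *: x) => //; rewrite linearZ /= /rank_one_map xb.
by rewrite scale1r.
Qed.

Lemma ell2_inner_finite x y N : (forall n, (N <= n)%N -> y n = 0) ->
  ell2_inner x y = \sum_(n < N) x n * (y n)^*.
Proof.
move=> y0; apply/eqP; rewrite -subr_eq0 -normc_eq0 eq_le normc_ge0 andbT.
apply/ler_addgt0Pr => e e0; rewrite add0r.
have [N0 /(_ (N + N0)%N (leq_addl _ _))] := ell2_inner_near x y e0.
have h : \sum_(i < N0) x (N + i)%N * (y (N + i)%N)^* = 0.
  by rewrite big1// => n _; rewrite y0 ?leq_addr// rmorph0 mulr0.
by rewrite big_split_ord /= h addr0 => /ltW.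
Qed.

Lemma ell2_innerBr x y z : ell2_inner x (y - z) = ell2_inner x y - ell2_inner x z.
Proof.
apply: (@cvg_lim R[i]^o); first exact: norm_hausdorff.
rewrite (_ : series _ = (fun n => series (fun n => x n * (y n)^*) n -
    series (fun n => x n * (z n)^*) n : R[i]^o)); last first.
  apply/funext => n; rewrite /series /= -sumrB.
  by apply: eq_bigr => k _; rewrite -[LHS]/(x k * (y k - z k)^*) rmorphB mulrBr.
by apply: cvgB; exact: cvg_ell2_inner.
Qed.

End ell2_operators.

(** * Topological transitivity *)

Section hypercyclicity.
Context {R : realType}.
Variables (T : {linear ell2 R -> ell2 R}) (M : R).
Hypothesis M0 : 0 <= M.
Hypothesis TM : forall x, ell2_norm (T x) <= M * ell2_norm x.

Lemma iter_linear n : linear (iter n T).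
Proof. by elim: n => // n IH c x y; rewrite !iterS IH linearP. Qed.

Lemma iter_linearB n x y : iter n T (x - y) = iter n T x - iter n T y.
Proof.
by rewrite addrC -scaleN1r iter_linear scaleN1r addrC.
Qed.

Lemma ell2_norm_iter n x : ell2_norm (iter n T x) <= M ^+ n * ell2_norm x.
Proof.
elim: n => [|n IH]; first by rewrite mul1r.
rewrite iterS exprS -mulrA; apply: (le_trans (TM _)).
by rewrite ler_wpM2l.
Qed.

Definition topologically_transitive := forall (x y : ell2 R) (e : R), 0 < e ->
  exists (z : ell2 R) n, ell2_norm (z - x) < e /\ ell2_norm (iter n T z - y) < e.

(* Every orbit starting in the new ball still passes near [y]; nesting such
   balls replaces the Baire category theorem. *)
Lemma transitive_step x y d r : topologically_transitive -> 0 < d -> 0 < r ->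
  exists (z : ell2 R) (d' : R), [/\ 0 < d' <= d / 2, ell2_norm (z - x) <= d / 2 &
    exists n, forall w, ell2_norm (w - z) <= d' -> ell2_norm (iter n T w - y) < r].
Proof.
move=> tr d0 r0; have e0 : 0 < Num.min (d / 2) (r / 2).
  by rewrite lt_min !divr_gt0.
have [z [n [zx zy]]] := tr x y _ e0.
move: zx zy; rewrite !lt_min => /andP[zx _] /andP[_ zy].
(* [T^n] has Lipschitz constant [M ^+ n]; adding 1 keeps the denominator positive, and the radius
   chosen below moves the image by at most [r / 2]. *)
have Mn0 : 0 < 2 * (M ^+ n + 1) by rewrite mulr_gt0// ltr_wpDl ?exprn_ge0.
exists z, (Num.min (d / 2) (r / (2 * (M ^+ n + 1)))); split.
- by rewrite lt_min !divr_gt0//= ge_min lexx.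
- exact: ltW.
exists n => w; rewrite le_min => /andP[_ wz].
rewrite -(subrKA (iter n T z)) -iter_linearB.
apply: (le_lt_trans (ler_ell2_normD _ _)); rewrite (splitr r).
apply: ler_ltD zy; apply: (le_trans (ell2_norm_iter _ _)).
apply: (le_trans (ler_wpM2l (exprn_ge0 n M0) wz)).
rewrite mulrCA ler_pM2l// invfM mulrCA ler_piMr ?invr_ge0//.
by rewrite ler_pdivrMr ?mul1r ?lerDl// ltr_wpDl ?exprn_ge0.
Qed.

(** Every open ball contains a target ball with center [t k] and radius [r k]. Nested closed balls
    are built so that every orbit starting in the [(k+1)]-st visits the [k]-th target; the limit of
    the centers lies in all of them. *)
Lemma topologically_transitive_hypercyclic (t : nat -> ell2 R) (r : nat -> R) :
  (forall k, 0 < r k) ->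
  (forall x e, 0 < e -> exists2 k, ell2_norm (t k - x) < e & r k < e) ->
  topologically_transitive -> hypercyclic T.
Proof.
move=> r0 dense_t tr.
have [f fP] : {f : nat * (ell2 R * R) -> ell2 R * R & forall ks, 0 < ks.2.2 ->
    [/\ 0 < (f ks).2 <= ks.2.2 / 2, ell2_norm ((f ks).1 - ks.2.1) <= ks.2.2 / 2 &
    exists n, forall w, ell2_norm (w - (f ks).1) <= (f ks).2 ->
      ell2_norm (iter n T w - t ks.1) < r ks.1]}.
  apply: (@choice _ _ (fun ks s => 0 < ks.2.2 ->
    [/\ 0 < s.2 <= ks.2.2 / 2, ell2_norm (s.1 - ks.2.1) <= ks.2.2 / 2 &
    exists n, forall w, ell2_norm (w - s.1) <= s.2 ->
      ell2_norm (iter n T w - t ks.1) < r ks.1])) => -[k [x d]] /=.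
  have [d0|nd0] := boolP (0 < d); last by exists (x, d).
  have [z [d' H]] := transitive_step x (t k) tr d0 (r0 k).
  by exists (z, d').
pose s := fix s k := if k is k'.+1 then f (k', s k') else (0 : ell2 R, 1 : R).
have s0 k : 0 < (s k).2.
  by elim: k => [|k IH] //=; case: (fP (k, s k) IH) => /andP[].
have sP k := fP (k, s k) (s0 k).
have sd k j : (s (k + j)%N).2 <= (s k).2 * eps j.
  elim: j => [|j IH]; first by rewrite addn0 /eps invr1 mulr1.
  rewrite addnS epsS mulrA; case: (sP (k + j)%N) => /andP[_ h] _ _.
  by apply: (le_trans h); rewrite ler_pM2r.
(* The center moves by at most half the current radius while the radius is at least halved, so later
   centers stay in every earlier ball. *)
have sx k j : ell2_norm ((s (k + j)%N).1 - (s k).1) <= (s k).2 * (1 - eps j).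
  elim: j => [|j IH].
    by rewrite addn0 subrr ell2_norm0 /eps invr1 subrr mulr0.
  rewrite addnS -(subrKA (s (k + j)%N).1); apply: (le_trans (ler_ell2_normD _ _)).
  case: (sP (k + j)%N) => _ h _; apply: (le_trans (lerD h IH)).
  by have := sd k j; rewrite epsS; lra.
have sx1 k : ell2_norm ((s k.+1).1 - (s k).1) <= 1 * eps k.
  case: (sP k) => _ h _; apply: (le_trans h).
  have := sd 0%N k; rewrite /= !mul1r; have := s0 k; lra.
have [l lP] := geometric_cauchy_cvg ler01 sx1.
have ls k : ell2_norm (l - (s k).1) <= (s k).2.
  apply/ler_addgt0Pr => e e0.
  have [j je] : exists j, eps j < e / 2 by apply: eps_lt; rewrite divr_gt0.
  rewrite -(subrKA (s (k + j)%N).1); apply: (le_trans (ler_ell2_normD _ _)).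
  rewrite addrC lerD//.
    apply: (le_trans (sx k j)); rewrite ler_piMr ?(ltW (s0 k))// gerBl.
    exact/ltW/eps_gt0.
  apply: (le_trans (lP _)).
  have : eps (k + j) <= eps j :> R.
    rewrite /eps lef_pV2 ?posrE ?exprn_gt0// ler_weXn2l ?leq_addl//.
    by rewrite ler1n.
  lra.
exists l => O [y Oy] oO.
have [[e i0]] : exists2 e : R[i], 0 < e & ball y e `<=` O.
  by apply/nbhs_ballP; exact: open_nbhs_nbhs.
rewrite ltcE/= => /andP[/eqP-> e0] eO.
have e20 : 0 < e / 2 by rewrite divr_gt0.
have [k tk rk] := dense_t y _ e20.
have [_ _ [n /(_ l (ls k.+1)) nP]] := sP k.
exists (iter n T l); split; last by exists n.
apply: eO; rewrite -ball_normE /ball_/= ell2_normE ltcR ell2_norm_distC.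
rewrite -(subrKA (t k)); apply: (le_lt_trans (ler_ell2_normD _ _)).
by rewrite (splitr e) ltrD// (lt_trans nP).
Qed.

End hypercyclicity.

(** * Transitivity from eigenvectors whose eigenvalues are roots of unity *)

Section unimodular_eigenvectors.
Context {R : realType}.
Variables (T : {linear ell2 R -> ell2 R}) (u : nat -> ell2 R) (m : nat -> R[i]).
Hypothesis Tu : forall k, T (u k) = m k *: u k.

Definition comb (c : nat -> R[i]) K : ell2 R := \sum_(i < K) c i *: u i.

Definition dense_span := forall x e, 0 < e ->
  exists c K, ell2_norm (x - comb c K) < e.

Lemma iter_eigenvector n k : iter n T (u k) = m k ^+ n *: u k.
Proof.
elim: n => [|n IH]; first by rewrite scale1r.
by rewrite iterS IH linearZ /= Tu scalerA -exprSr.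
Qed.

Lemma big_ord_support (V : nmodType) (f : nat -> V) K L :
  (K <= L)%N -> (forall i, (K <= i)%N -> f i = 0) ->
  \sum_(i < L) f i = \sum_(i < K) f i.
Proof.
move=> KL f0; rewrite -(subnKC KL) big_split_ord /= [X in _ + X = _]big1 ?addr0//.
by move=> i _; rewrite f0// leq_addr.
Qed.

Definition truncate (c : nat -> R[i]) K i := if (i < K)%N then c i else 0.

Lemma comb_truncate c K L : (K <= L)%N -> comb (truncate c K) L = comb c K.
Proof.
move=> KL; rewrite /comb.
rewrite (big_ord_support (K := K) (f := fun i => truncate c K i *: u i))//.
  by apply: eq_bigr => i _; rewrite /truncate ltn_ord.
by move=> i Ki; rewrite /truncate ltnNge Ki scale0r.
Qed.

Lemma iter_linear_sum n I (r : seq I) (P : pred I) (F : I -> ell2 R) :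
  iter n T (\sum_(i <- r | P i) F i) = \sum_(i <- r | P i) iter n T (F i).
Proof. by elim: n => // n IH; rewrite iterS IH linear_sum. Qed.

Lemma iter_linearZ n c x : iter n T (c *: x) = c *: iter n T x.
Proof. by elim: n => // n IH; rewrite !iterS IH linearZ. Qed.

Variable l : nat -> R[i].
Hypothesis lmP : forall N, next_point N l m (l N) (m N).
Hypothesis close : forall k, (0 < k)%N -> ell2_norm (u k - u (parent k)) <= 4 * eps k.
Hypothesis uD : dense_span.

Lemma levelD g i : (i < 2 ^ g)%N -> level (i + 2 ^ g) = g.
Proof.
move=> ig; apply: trunc_log_eq => //.
by rewrite leq_addl expnS mul2n -addnn ltn_add2r.
Qed.

(** Exponents are multiplied together one index at a time. The extra factors are odd, hence they
    preserve both the value 1 and the value -1. *)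
Lemma common_exponent g n : (n <= 2 ^ g)%N -> exists2 w, odd w &
  forall i, (i < n)%N -> m i ^+ (2 ^ g * w) = 1 /\ m (i + 2 ^ g)%N ^+ (2 ^ g * w) = -1.
Proof.
elim: n => [|n IH] ng; first by exists 1%N.
have [w ow wP] := IH (ltnW ng).
have [w1 ow1 w1P] : exists2 w, odd w & m n ^+ (2 ^ g * w) = 1.
  apply: (@level_root _ l m n.+1) => //.
  exact: (next_base (lmP 0%N)).
have [|w2 ow2 w2P] := next_root (lmP (n + 2 ^ g)%N).
  by rewrite addn_gt0 expn_gt0 orbT.
rewrite levelD// in w2P.
exists (w * (w1 * w2))%N; first by rewrite !oddM ow ow1 ow2.
move=> i; rewrite ltnS leq_eqVlt => /orP[/eqP->|/wP[h1 h2]].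
  rewrite (_ : 2 ^ g * _ = 2 ^ g * w1 * (w * w2))%N; last by ring.
  rewrite exprM w1P expr1n; split=> //.
  rewrite (_ : 2 ^ g * w1 * _ = 2 ^ g * w2 * (w * w1))%N; last by ring.
  by rewrite exprM w2P -signr_odd oddM ow ow1.
rewrite mulnA !(exprM _ (2 ^ g * w)%N) h1 h2 expr1n; split=> //.
by rewrite -signr_odd oddM ow1 ow2.
Qed.

Lemma normc_half : normc (2^-1 : R[i]) = 2^-1.
Proof. by rewrite normcV -(rmorph_nat (real_complex R)) normc_real normr_nat. Qed.

Lemma eigenvectors_transitive : topologically_transitive T.
Proof.
move=> x y e e0; have e20 : 0 < e / 2 by rewrite divr_gt0.
have [c0 [K1 xc]] := uD x e20; have [d0 [K2 yd]] := uD y e20.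
pose c := truncate c0 K1; pose d := truncate d0 K2; pose K := (K1 + K2)%N.
pose S : R := \sum_(i < K) normc (c i - d i).
have S0 : 0 <= S by rewrite sumr_ge0// => i _; exact: normc_ge0.
have S1 : 0 < 4 * (S + 1) by rewrite mulr_gt0// ltr_wpDl.
(* By closeness to the parent, [rest] has norm at most [2 * S * eps g0], which this choice makes
   smaller than [e / 2]. *)
have [g0 g0e] : exists g0, eps g0 < e / 4 / (S + 1) :> R.
  by apply: eps_lt; rewrite !divr_gt0// ltr_wpDl.
(* [2 ^ g] must exceed the supports of [c] and [d], and also [g0], so that the children [i + 2 ^ g]
   are close to their parents. *)
pose g := maxn g0 K.
have Kg : (K <= 2 ^ g)%N by rewrite (leq_trans (leq_maxr g0 K))// ltnW// ltn_expl.
pose L := (2 ^ g)%N.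
have epsL i : eps (i + L) <= eps g0 :> R.
  rewrite /eps lef_pV2 ?posrE ?exprn_gt0// ler_weXn2l ?ler1n//.
  apply: leq_trans (leq_addl _ _); apply: (leq_trans (leq_maxl g0 K)).
  by rewrite ltnW// ltn_expl.
have [w _ wP] := common_exponent (leqnn (2 ^ g)).
pose z := \sum_(i < L) (((c i + d i) / 2) *: u i + ((c i - d i) / 2) *: u (i + L)%N).
(* The cost of replacing parents by children; it occurs with opposite signs in [z] and in its
   image. *)
pose rest := \sum_(i < L) ((c i - d i) / 2) *: (u (i + L)%N - u i).
have K1L : (K1 <= L)%N by rewrite (leq_trans _ Kg)// leq_addr.
have K2L : (K2 <= L)%N by rewrite (leq_trans _ Kg)// leq_addl.
have zE : z = comb c0 K1 + rest.
  rewrite -(comb_truncate _ K1L) /comb /z /rest -big_split /=; apply: eq_bigr => i _.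
  rewrite scalerBr addrCA addrC; congr (_ + _).
  by rewrite -/(c i) -scalerBl; congr (_ *: _); field.
have TzE : iter (2 ^ g * w) T z = comb d0 K2 - rest.
  rewrite -(comb_truncate _ K2L) /comb /z /rest iter_linear_sum -sumrB.
  apply: eq_bigr => i _; rewrite iter_linear.
  have [h1 h2] := wP i (ltn_ord i).
  rewrite iter_linearZ !iter_eigenvector h1 h2 scale1r scaleN1r scalerN.
  rewrite -/(d i) [in RHS]scalerBr opprB [RHS]addrA -scalerDl.
  congr (_ *: _ - _).
  by field.
have restE : ell2_norm rest < e / 2.
  apply: (le_lt_trans (ell2_norm_sum _ _ _)).
  apply: (@le_lt_trans _ _ (\sum_(i < L) normc (c i - d i) * (2 * eps g0))).
    apply: ler_sum => i _; rewrite ell2_normZ normcM.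
    rewrite normc_half -mulrA ler_wpM2l ?normc_ge0//.
    have := close (k := (i + L)%N); rewrite addn_gt0 expn_gt0 orbT => /(_ isT).
    have -> : parent (i + L) = i by rewrite /parent levelD// addnK.
    have := epsL i; lra.
  rewrite -mulr_suml (big_ord_support (K := K) (f := fun i => normc (c i - d i)))//.
    have := eps_gt0 (R := R) g0; move: g0e; rewrite ltr_pdivlMr ?ltr_wpDl// -/S; nra.
  move=> i Ki; rewrite /c /d /truncate !ltnNge.
  rewrite (leq_trans _ Ki) ?leq_addr// (leq_trans _ Ki) ?leq_addl//.
  by rewrite subrr normc0.
exists z, (2 ^ g * w)%N; split.
  rewrite zE addrAC; apply: le_lt_trans (ler_ell2_normD _ _) _.
  by rewrite (splitr e) ltrD// (ell2_norm_distC _ x).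
rewrite TzE addrAC; apply: le_lt_trans (ler_ell2_normD _ _) _.
rewrite (splitr e) ltrD// ?(ell2_norm_distC _ y)//.
by rewrite -[- rest]sub0r ell2_norm_distC subr0.
Qed.
End unimodular_eigenvectors.

(** * A countable dense family of rational combinations *)

Section countable_dense.
Context {R : realType}.

Definition complex_of_rat2 (q : rat * rat) : R[i] := ratr q.1 +i* ratr q.2.

Lemma normc_le_ReIm (z : R[i]) : normc z <= `|complex.Re z| + `|complex.Im z|.
Proof.
rewrite -(@ler_pXn2r _ 2)// ?nnegrE ?normc_ge0 ?addr_ge0// sqr_normcE.
rewrite sqrrD !real_normK ?num_real//.
by rewrite addrAC lerDl mulrn_wge0// mulr_ge0.
Qed.

Lemma rat2_dense (z : R[i]) (e : R) : 0 < e ->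
  exists q, normc (z - complex_of_rat2 q) < e.
Proof.
move=> e0; have e20 : 0 < e / 2 by rewrite divr_gt0.
have approx (a : R) : exists q, `|a - ratr q| < e / 2.
  have ab : a - e / 2 < a + e / 2 by lra.
  have [q] := rat_in_itvoo ab.
  by rewrite in_itv /= => /andP[h1 h2]; exists q; rewrite ltr_norml; lra.
case: z => a b; have [p pP] := approx a; have [q qP] := approx b.
exists (p, q); apply: (le_lt_trans (normc_le_ReIm _)) => /=.
by rewrite (splitr e) ltrD.
Qed.

(** An index codes both a precision [p] and a list of rational coefficients, so every point of the
    family is paired with arbitrarily small radii. *)
Lemma countable_dense_combinations (u : nat -> ell2 R) : dense_span u ->
  exists (t : nat -> ell2 R) (r : nat -> R), (forall k, 0 < r k) /\
    forall x e, 0 < e -> exists2 k, ell2_norm (t k - x) < e & r k < e.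
Proof.
move=> uD.
pose code k := unpickle k : option (nat * seq (rat * rat)).
pose t k := if code k is Some (p, s) then
  comb u (fun i => complex_of_rat2 (nth (0, 0) s i)) (size s) else 0.
pose r k : R := if code k is Some (p, s) then eps p else 1.
exists t, r; split.
  by move=> k; rewrite /r; case: (code k) => [[p s]|] //; exact: eps_gt0.
move=> x e e0; have e20 : 0 < e / 2 by rewrite divr_gt0.
have [c [K cK]] := uD x _ e20; have [p pe] := eps_lt e0.
pose S := \sum_(i < K) ell2_norm (u i).
have S0 : 0 <= S by rewrite sumr_ge0// => i _; exact: ell2_norm_ge0.
have S1 : 0 < S + 1 by rewrite ltr_wpDl.
have [q qP] := @choice _ _ _ (fun i => rat2_dense (c i) (divr_gt0 e20 S1)).
exists (pickle (p, mkseq q K)); last by rewrite /r /code pickleK.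
rewrite /t /code pickleK size_mkseq ell2_norm_distC -(subrKA (comb u c K)).
apply: (le_lt_trans (ler_ell2_normD _ _)); rewrite (splitr e).
apply: ltr_leD cK _; rewrite /comb -sumrB.
apply: (le_trans (ell2_norm_sum _ _ _)).
apply: (@le_trans _ _ (\sum_(i < K) (e / 2 / (S + 1)) * ell2_norm (u i))).
  apply: ler_sum => i _; rewrite -scalerBl ell2_normZ ler_wpM2r ?ell2_norm_ge0//.
  by rewrite nth_mkseq// ltW.
rewrite -mulr_sumr -/S mulrAC ler_pdivrMr// ler_wpM2l ?lerDl// ltW//.
Qed.

End countable_dense.

(** * Density of a span containing a small perturbation of the canonical basis *)

Section density.
Context {R : realType}.
Variables (u v : nat -> ell2 R).

(** Allowing every length [L >= K] lets two combinations be added over a common index range. *)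
Definition in_span x := exists c K, (forall i, (K <= i)%N -> c i = 0) /\
  forall L, (K <= L)%N -> x = comb u c L.

Lemma in_spanD x y : in_span x -> in_span y -> in_span (x + y).
Proof.
move=> [c [K [cK cE]]] [d [L [dL dE]]]; exists (c \+ d), (K + L)%N; split.
  move=> i KLi; rewrite /= cK ?dL ?addr0// (leq_trans _ KLi)//.
    exact: leq_addl.
  exact: leq_addr.
move=> N KLN; rewrite (cE N) ?(dE N) ?(leq_trans _ KLN) ?leq_addl ?leq_addr//.
by rewrite /comb -big_split; apply: eq_bigr => i _; rewrite scalerDl.
Qed.

Lemma in_spanZ a x : in_span x -> in_span (a *: x).
Proof.
move=> [c [K [cK cE]]]; exists (fun i => a * c i), K; split.
  by move=> i Ki; rewrite cK// mulr0.
move=> N KN; rewrite (cE N)// /comb scaler_sumr.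
by apply: eq_bigr => i _; rewrite scalerA.
Qed.

Lemma in_span0 : in_span 0.
Proof.
exists (fun=> 0), 0%N; split=> // L _.
by rewrite /comb big1// => i _; rewrite scale0r.
Qed.

Lemma in_span_gen k : in_span (u k).
Proof.
exists (fun i => (i == k)%:R), k.+1; split=> [i ki|L kL].
  by rewrite gtn_eqF.
rewrite /comb (bigD1 (Ordinal kL))//= eqxx scale1r big1 ?addr0// => i.
by rewrite -val_eqE /= => /negbTE ->; rewrite scale0r.
Qed.

Lemma in_span_sum n (F : nat -> ell2 R) : (forall k, in_span (F k)) ->
  in_span (\sum_(k < n) F k).
Proof.
move=> FS; elim/big_ind : _ => //; [exact: in_span0|exact: in_spanD].
Qed.
(* [v k] is so close to the [k]-th canonical basis vector that replacing the
   latter by [v k] moves any vector by at most a fixed fraction of its norm. *)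
Hypothesis v_span : forall k, in_span (v k).
Hypothesis v_close : forall k n,
  normc (v k n - (k == n)%:R) <= eps k * eps n / 16.

Lemma sum_delta (x : ell2 R) K n :
  \sum_(k < K) x k * (k == n :> nat)%:R = if (n < K)%N then x n else 0.
Proof.
case: ltnP => [nK|Kn].
  rewrite (bigD1 (Ordinal nK))//= eqxx mulr1 big1 ?addr0// => i.
  by rewrite -val_eqE /= => /negbTE ->; rewrite mulr0.
by rewrite big1// => i _; rewrite ltn_eqF ?mulr0// (leq_trans (ltn_ord i)).
Qed.

(** Discarding the tail of [x] costs a quarter of its norm, and replacing the first [K] basis
    vectors by [v k] costs another quarter. *)
Lemma half_approximation x : exists2 y, in_span y &
  ell2_norm (x - y) <= ell2_norm x / 2.
Proof.
have [/eqP x0|x0] := boolP (ell2_norm x == 0).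
  by exists 0; [exact: in_span0|rewrite subr0 x0 mul0r].
have X0 : 0 < ell2_norm x by rewrite lt_neqAle eq_sym x0 ell2_norm_ge0.
have [K KP] := @ell2_tail _ x (ell2_norm x / 4) (divr_gt0 X0 (ltr0Sn _ 3)).
pose w := \sum_(k < K) x k *: v k.
exists w; first by apply: (@in_span_sum K (fun k => x k *: v k)) => k; exact: in_spanZ.
pose d n := \sum_(k < K) x k * (v k n - (k == n :> nat)%:R).
(* [d] is [w] minus the truncation of [x]. The [eps k] sum to at most 2, hence 2/16 = 1/8; the norm
   estimate then doubles this to 1/4. *)
have dle n : normc (d n) <= ell2_norm x / 8 * eps n.
  apply: (le_trans (normc_sum _ _ _)).
  apply: (@le_trans _ _ (\sum_(k < K) (ell2_norm x * eps n / 16 * eps k))).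
    apply: ler_sum => k _; rewrite normcM.
    rewrite (_ : _ * eps k = ell2_norm x * (eps k * eps n / 16)); last by ring.
    by apply: ler_pM; rewrite ?normc_ge0 ?normc_le_ell2_norm.
  rewrite -mulr_sumr sum_eps.
  have := mulr_ge0 (ell2_norm_ge0 x) (ltW (eps_gt0 (R := R) n)).
  by move: (mulr_ge0 (mulr_ge0 (ell2_norm_ge0 x) (ltW (eps_gt0 (R := R) n)))
    (ltW (eps_gt0 (R := R) K))); lra.
have x80 : 0 <= ell2_norm x / 8 by rewrite divr_ge0// ell2_norm_ge0.
pose D : ell2 R := ell2_of (geometric_square_summable x80 dle).
have Dle : ell2_norm D <= ell2_norm x / 4.
  by apply: (le_trans (@geometric_ell2_norm _ D _ x80 dle)); lra.
have dE n : d n = w n - if (n < K)%N then x n else 0.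
  rewrite /w ell2_sumE -sum_delta -sumrB; apply: eq_bigr => k _.
  by rewrite mulrBr.
have tE : ell2_norm (x - w + D) <= ell2_norm x / 4.
  apply: KP => n nK; rewrite -[LHS]/(x n - w n + d n) dE.
    by rewrite nK; ring.
  by rewrite ltnNge nK /=; ring.
rewrite -(addrK D (x - w)); apply: (le_trans (ler_ell2_normD _ _)).
rewrite ell2_normN.
by apply: (le_trans (lerD tE Dle)); lra.
Qed.

(** The half approximation is iterated on the residual [x - y]. *)
Lemma eps_approximation n x : exists2 y, in_span y &
  ell2_norm (x - y) <= eps n * ell2_norm x.
Proof.
elim: n => [|n [y yS yx]].
  by exists 0; [exact: in_span0|rewrite subr0 /eps invr1 mul1r].
have [z zS zx] := half_approximation (x - y).
exists (y + z); first exact: in_spanD.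
by rewrite opprD addrA (le_trans zx)// epsS; lra.
Qed.

Lemma near_basis_dense_span : dense_span u.
Proof.
move=> x e e0.
have x1 : 0 < ell2_norm x + 1 by rewrite ltr_wpDl ?ell2_norm_ge0.
have [n] := eps_lt (divr_gt0 e0 x1); rewrite ltr_pdivlMr// => ne.
have [y [c [K [_ yE]]] xy] := eps_approximation n x.
exists c, K; rewrite -yE//; apply: (le_lt_trans xy); apply: le_lt_trans ne.
by rewrite ler_wpM2l ?lerDl// ltW// eps_gt0.
Qed.
End density.

(** * The perturbed operator *)

Section perturbation.
Context {R : realType}.
Variables l m : nat -> R[i].
Hypothesis lmP : forall N, next_point N l m (l N) (m N).

Lemma eps_le1 n : eps n <= 1 :> R.
Proof. by rewrite invf_le1 ?exprn_gt0// exprn_ege1// ler1n. Qed.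

Lemma eps_le k n : (k <= n)%N -> eps n <= eps k :> R.
Proof.
by move=> kn; rewrite /eps lef_pV2 ?posrE ?exprn_gt0// ler_weXn2l// ler1n.
Qed.

Lemma normc_weight_mul k (z : R[i]) : normc ((weight k)%:C * z) = weight k * normc z.
Proof. by rewrite normcM normc_real ger0_norm// ltW// weight_gt0. Qed.

Lemma eigvec_diag k : eigvec_seq l m k k = (weight k)%:C.
Proof. by rewrite /eigvec_seq divff ?mulr1// subr_eq0 next_m_neq_l. Qed.

Lemma eigvec_tail k n : (k < n)%N ->
  normc (eigvec_seq l m k n) <= weight n * eta n.
Proof.
move=> kn; rewrite normc_weight_mul ler_wpM2l ?(ltW (weight_gt0 _))//.
rewrite normcM normcV ler_pdivrMr ?normc_gt0 ?subr_eq0 ?next_m_neq_l//.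
exact: next_tail (lmP n) _ kn.
Qed.

Lemma eigvec_head k n : (n < k)%N ->
  normc (eigvec_seq l m k n - eigvec_seq l m (parent k) n) <= eta k.
Proof. by move=> nk; apply: (next_close (lmP k)) => //; exact: leq_ltn_trans nk. Qed.

Lemma weight_eta_le n : weight n * eta n <= eps n :> R.
Proof.
have := eps_le1 n; have := eps_gt0 (R := R) n; rewrite /weight /eta.
move: (eps n) => e e0 e1.
have e21 : e ^+ 6 <= e by rewrite -[leRHS]expr1 ler_wiXn2l// ltW.
have : 0 <= e ^+ 6 by rewrite exprn_ge0// ltW.
rewrite mulrA -exprD; lra.
Qed.

Lemma eigvec_summable k : square_summable (eigvec_seq l m k).
Proof.
(* The sum covers the coordinates up to [k], and the summand 1 covers the tail. *)
pose M : R := 1 + \sum_(i < k.+1) normc (eigvec_seq l m k i) / eps i.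
have S0 (P : pred 'I_k.+1) :
    0 <= \sum_(i < k.+1 | P i) normc (eigvec_seq l m k i) / eps i.
  by apply: sumr_ge0 => i _; rewrite divr_ge0 ?normc_ge0// ltW// eps_gt0.
apply: (@geometric_square_summable _ _ M) => [|n]; first by rewrite addr_ge0.
have [nk|kn] := leqP n k.
  rewrite -ler_pdivrMr ?eps_gt0// /M (bigD1 (Ordinal (nk : (n < k.+1)%N)))//=.
  by rewrite addrCA lerDl addr_ge0.
apply: (le_trans (eigvec_tail kn)); apply: (le_trans (weight_eta_le n)).
by rewrite ler_peMl ?(ltW (eps_gt0 _))// lerDl S0.
Qed.

Definition eigvec k : ell2 R := ell2_of (@eigvec_summable k).

(** Up to small errors the difference is [weight k] times the [k]-th basis vector: heads nearly
    cancel below [k], and at [k] the parent, like both vectors beyond [k], only contributes a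
    tail. *)
Lemma parent_bounds k n : (0 < k)%N ->
  [/\ (n < k)%N -> normc ((eigvec k - eigvec (parent k)) n) <= eta k,
      n = k -> normc ((eigvec k - eigvec (parent k)) n - (weight k)%:C) <=
        weight k * eta k &
      (k < n)%N -> normc ((eigvec k - eigvec (parent k)) n) <= 2 * weight n * eta n].
Proof.
move=> k0; rewrite (_ : (eigvec k - eigvec (parent k)) n =
  eigvec_seq l m k n - eigvec_seq l m (parent k) n)//.
have pk := parent_lt k0; split=> [|->|kn]; first exact: eigvec_head.
  rewrite eigvec_diag addrAC subrr add0r normcN; exact: eigvec_tail.
apply: (le_trans (le_normcD _ _)); rewrite normcN.
have h1 := eigvec_tail kn; have h2 := eigvec_tail (ltn_trans pk kn); lra.
Qed.

Lemma eps_expr_le (a b : nat) n : (b <= a)%N -> eps n ^+ a <= eps n ^+ b :> R.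
Proof. by move=> ba; rewrite ler_wiXn2l// ?eps_le1// ltW// eps_gt0. Qed.

Lemma eps_sqr_le k n : (k <= n)%N -> eps n ^+ 2 <= eps k * eps n :> R.
Proof. by move=> kn; rewrite expr2 ler_pM2r ?eps_gt0// eps_le. Qed.

Lemma eigvec_close k : (0 < k)%N ->
  ell2_norm (eigvec k - eigvec (parent k)) <= 4 * eps k.
Proof.
move=> k0; have e0 := eps_gt0 (R := R) k.
apply: (@le_trans _ _ (2 * (2 * eps k))); last by lra.
apply: geometric_ell2_norm => [|n]; first by rewrite mulr_ge0// ltW.
have f0 := eps_gt0 (R := R) n.
have [h1 h2 h3] := parent_bounds n k0; case: (ltngtP n k) => [nk|kn|nk].
- apply: (le_trans (h1 nk)); rewrite /eta.
  have := eps_sqr_le (ltnW nk); have := @eps_expr_le 4 2 k isT.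
  have := mulr_gt0 e0 f0; lra.
- apply: (le_trans (h3 kn)); rewrite /eta /weight mulrA -(mulrA 2) -exprD.
  have := eps_sqr_le (ltnW kn); have := @eps_expr_le 6 2 n isT.
  have := mulr_gt0 e0 f0; lra.
- rewrite -[X in normc X](subrK (weight k)%:C).
  apply: (le_trans (le_normcD _ _)); rewrite normc_real gtr0_norm ?weight_gt0//.
  apply: (le_trans (lerD (h2 nk) (lexx _))); rewrite nk /weight /eta mulrA -exprD.
  have := @eps_expr_le 6 2 k isT; have := exprn_gt0 2 e0; lra.
Qed.

(** Rescaled so that the [k]-th coordinate is close to 1. As [parent 0 = 0], the difference would
    vanish at 0, where [eigvec 0] itself serves since [weight 0 = 1]. *)
Definition near_basis k : ell2 R :=
  if k is 0 then eigvec 0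
  else (weight k)^-1%:C *: (eigvec k - eigvec (parent k)).

Lemma near_basis_span k : in_span eigvec (near_basis k).
Proof.
case: k => [|k]; first exact: in_span_gen.
apply: in_spanZ; apply: in_spanD; first exact: in_span_gen.
by rewrite -scaleN1r; apply: in_spanZ; exact: in_span_gen.
Qed.

Lemma near_basis_close k n :
  normc (near_basis k n - (k == n)%:R) <= eps k * eps n / 16.
Proof.
have e0 := eps_gt0 (R := R) k; have f0 := eps_gt0 (R := R) n.
have ef0 := mulr_gt0 e0 f0.
have [k0|k0] := posnP k.
  rewrite k0 /near_basis -[eigvec 0 n]/(eigvec_seq l m 0 n).
  rewrite /eps expr0 invr1 mul1r -/(eps n).
  have [<-|n0] := eqVneq 0%N n.
    by rewrite eigvec_diag /weight /eps expr0 invr1 expr1n subrr normc0 divr_ge0.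
  rewrite subr0; apply: (le_trans (eigvec_tail _)); first by rewrite lt0n eq_sym.
  rewrite /weight /eta mulrA -exprD.
  have := @eps_expr_le 6 1 n isT; rewrite expr1; lra.
have w0 := weight_gt0 (R := R) k.
have -> : near_basis k n - (k == n)%:R =
  (weight k)^-1%:C * ((eigvec k - eigvec (parent k)) n - (weight k)%:C * (k == n)%:R).
  have -> : near_basis k n = (weight k)^-1%:C * (eigvec k - eigvec (parent k)) n.
    by case: (k) k0.
  have wK : (weight k)^-1%:C * (weight k)%:C = 1 :> R[i].
    by rewrite -rmorphM /= mulVf ?gt_eqF.
  by rewrite [RHS]mulrBr (mulrA _ (weight k)%:C) wK mul1r.
rewrite normcM normc_real gtr0_norm ?invr_gt0// ler_pdivrMl//.
have [h1 h2 h3] := parent_bounds n k0; case: (ltngtP n k) => [nk|kn|nk].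
- rewrite mulr0 subr0; apply: (le_trans (h1 nk)); rewrite /eta /weight.
  have := ler_wpM2l (ltW (exprn_gt0 2 e0)) (eps_sqr_le (ltnW nk)).
  have := mulr_gt0 (exprn_gt0 2 e0) ef0; lra.
(* The chain is [eps n ^+ 6 <= eps n ^+ 4 <= eps k ^+ 2 * eps n ^+ 2 <= eps k ^+ 3 * eps n]. *)
- rewrite mulr0 subr0; apply: (le_trans (h3 kn)); rewrite /eta /weight.
  have h4 := eps_sqr_le (ltnW kn).
  have h5 := ler_wpM2l (ltW (exprn_gt0 2 e0)) h4.
  have f20 := ltW (exprn_gt0 2 f0).
  have h6 := ler_pM f20 f20 h4 h4.
  have h7 := @eps_expr_le 6 4 n isT.
  have := mulr_gt0 (exprn_gt0 2 e0) ef0; lra.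
- rewrite mulr1; apply: (le_trans (h2 nk)); rewrite nk ler_pM2l// /eta.
  have := @eps_expr_le 4 2 k isT; have := exprn_gt0 2 e0; lra.
Qed.

Lemma eigvec_dense_span : dense_span eigvec.
Proof. exact: near_basis_dense_span near_basis_span near_basis_close. Qed.

End perturbation.

(** * The dual vector [b], the perturbation vector [a], and the eigenvalue equation *)

Section dual_vector.
Context {R : realType}.
Variables l m : nat -> R[i].
Hypothesis lmP : forall N, next_point N l m (l N) (m N).

Lemma finite_support_summable (f : nat -> R[i]) N :
  (forall n, (N <= n)%N -> f n = 0) -> square_summable f.
Proof.
move=> f0; apply: (@square_summable_le _ _ (\sum_(i < N) normc (f i) ^+ 2)) => K.
rewrite /series /= big_mkord.
rewrite -(@big_ord_support _ (fun i => normc (f i) ^+ 2) N (N + K)) ?leq_addr//.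
  rewrite addnC big_split_ord /= lerDl sumr_ge0// => i _; exact: sqr_ge0.
by move=> i Ni; rewrite f0// normc0 expr0n.
Qed.

Definition dual_seq N n : R[i] :=
  if (n < N)%N then (partial_dual l m N n)^* else 0.

Lemma dual_seq0 N n : (N <= n)%N -> dual_seq N n = 0.
Proof. by rewrite /dual_seq ltnNge => ->. Qed.

Definition dual_trunc N : ell2 R := ell2_of (finite_support_summable (@dual_seq0 N)).

Lemma eigvec_dual N k : (k < N)%N -> ell2_inner (eigvec lmP k) (dual_trunc N) = 1.
Proof.
move=> kN; rewrite (@ell2_inner_finite _ _ _ N); last exact: dual_seq0.
rewrite -(sum_eigvec_dual lmP kN); apply: eq_bigr => n _.
by rewrite /dual_trunc /= /dual_seq ltn_ord conjCK.
Qed.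

(** Below [N] the old coordinates change by the quantity bounded in [next_dual]; at [N] the new one
    is small by [next_small], even after division by [weight N]. *)
Lemma dualS N : ell2_norm (dual_trunc N.+1 - dual_trunc N) <= 2 * eps N.
Proof.
have e0 := eps_gt0 (R := R) N.
apply: geometric_ell2_norm => [|n]; first exact: ltW.
rewrite (_ : (dual_trunc N.+1 - dual_trunc N) n =
  dual_seq N.+1 n - dual_seq N n)// /dual_seq.
have f0 := eps_gt0 (R := R) n; have ef0 := mulr_gt0 e0 f0.
have etale : eta N <= eps N ^+ 4 :> R.
  by rewrite /eta ler_pdivrMr// ler_peMr ?ler1n// exprn_ge0// ltW.
case: (ltngtP n N) => [nN|Nn|->].
- rewrite ltnS (ltnW nN) -rmorphB normc_conj partial_dualS//.
  have nl := next_l_neq lmP (negbT (ltn_eqF nN)).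
  rewrite (_ : _ - _ = partial_dual l m N n * ((m N - l N) / (l n - l N)) * -1).
    rewrite normcM normcN normc1 mulr1.
    apply: (le_trans (next_dual (lmP N) nN)); apply: (le_trans etale).
    rewrite [leRHS]mulrC; apply: (le_trans _ (@eps_sqr_le R n N (ltnW nN))).
    exact: eps_expr_le.
  by field; rewrite subr_eq0.
- rewrite ltnS leqNgt Nn [X in normc X](_ : _ = 0) ?normc0 ?ltW//; exact: subrr.
- rewrite leqnn subr0 normc_conj partial_dual_new normcM normc_real.
  rewrite gtr0_norm ?invr_gt0 ?weight_gt0// ler_pdivrMl ?weight_gt0//.
  (* For [N = 0] the product is empty and equals 1, which the bound still allows because
     [eps 0 = 1]. *)
  have [->|N0] := posnP N.
    by rewrite big_ord0 normc1 /weight /eps expr0 invr1 expr1n !mulr1.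
  apply: (le_trans (next_small (lmP N) N0)); apply: (le_trans etale).
  by rewrite /weight -expr2 -exprD.
Qed.

(** [b] is the limit of the truncated vectors. Each pairing with [eigvec k] is eventually 1, and
    Cauchy-Schwarz passes this to the limit. *)
Lemma dual_vector_exists : exists b : ell2 R, forall k, ell2_inner (eigvec lmP k) b = 1.
Proof.
have [b bP] := geometric_cauchy_cvg (ler0n _ 2) dualS.
exists b => k; apply/eqP; rewrite -subr_eq0 -normc_eq0 eq_le normc_ge0 andbT.
apply/ler_addgt0Pr => e e0; rewrite add0r.
have u1 : 0 < ell2_norm (eigvec lmP k) + 1 by rewrite ltr_wpDl ?ell2_norm_ge0.
(* The quarter offsets the bound [4 * eps N] on the distance from [b] to its truncations. *)
have [N Ne] := eps_lt (divr_gt0 (divr_gt0 e0 (ltr0Sn _ 3)) u1).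
rewrite ltr_pdivlMr// in Ne.
have kN : (k < N + k.+1)%N by rewrite addnS ltnS leq_addl.
rewrite -(eigvec_dual kN) -ell2_innerBr.
apply: (le_trans (normc_ell2_inner_le _ _)).
have := bP (N + k.+1)%N; have := @eps_le R _ _ (leq_addr k.+1 N).
have := ell2_norm_ge0 (eigvec lmP k); have := ell2_norm_ge0 (b - dual_trunc (N + k.+1)).
have := eps_gt0 (R := R) N.
move: Ne; set x := ell2_norm (eigvec _ _); set y := ell2_norm (b - _) => *; nra.
Qed.

Definition perturbation_seq n : R[i] := (weight n)%:C * (m n - l n).

Lemma perturbation_summable : square_summable perturbation_seq.
Proof.
apply: (@geometric_square_summable _ _ 2) => // n.
rewrite normc_weight_mul mulrC; apply: ler_pM.
- exact: normc_ge0.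
- exact/ltW/weight_gt0.
- apply: (le_trans (le_normcD _ _)); rewrite normcN.
  by rewrite (next_l_unit (lmP n)) (next_m_unit (lmP n)).
- by have := @eps_expr_le R 2 1 n isT; rewrite expr1.
Qed.

Definition perturbation_vector : ell2 R := ell2_of perturbation_summable.

Lemma perturbation_vector_neq0 : perturbation_vector != 0.
Proof.
apply/eqP => /(congr1 (fun x : ell2 R => x 0%N)).
rewrite -[LHS]/(perturbation_seq 0) -[RHS]/(0 : R[i]) => /eqP.
apply/negP; rewrite mulf_neq0//; first by rewrite gt_eqF// ltcR weight_gt0.
by rewrite subr_eq0 next_m_neq_l.
Qed.

Lemma l_unit n : normc (l n) = 1. Proof. exact: next_l_unit (lmP n). Qed.

(** Coordinatewise this is [l n / (m k - l n) + 1 = m k / (m k - l n)], multiplied by the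
    perturbation coordinate. *)
Lemma eigvec_eigen b k : ell2_inner (eigvec lmP k) b = 1 ->
  (diag_op l_unit \+ rank_one_map b perturbation_vector) (eigvec lmP k) =
  m k *: eigvec lmP k.
Proof.
move=> kb; apply/val_inj/funext => n.
rewrite /= /rank_one_map kb scale1r.
rewrite -[LHS]/(l n * eigvec_seq l m k n + perturbation_seq n).
rewrite -[RHS]/(m k * eigvec_seq l m k n) /eigvec_seq /perturbation_seq.
by field; rewrite subr_eq0 next_m_neq_l.
Qed.
End dual_vector.

Theorem theorem1p2 (R : realType) :
  exists U F : {linear ell2 R -> ell2 R},
    [/\ unitary U, bounded_operator F, rank_one F & hypercyclic (U \+ F)].
Proof.
have [l [m lmP]] := @sequences_exist R.
have [b bP] := dual_vector_exists lmP.
pose a := perturbation_vector lmP.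
exists (diag_op (l_unit lmP)), (rank_one_map b a); split.
- exact: diag_op_unitary.
- exact: rank_one_map_bounded.
- by apply: rank_one_mapP (bP 0%N) _; exact: perturbation_vector_neq0.
pose T : {linear ell2 R -> ell2 R} := (diag_op (l_unit lmP) \+ rank_one_map b a).
have Tu k : T (eigvec lmP k) = m k *: eigvec lmP k by exact: eigvec_eigen.
have [t [r [r0 tr]]] := countable_dense_combinations (eigvec_dense_span lmP).
apply: (@topologically_transitive_hypercyclic R T
  (1 + ell2_norm b * ell2_norm a) _ _ t r) => //.
- by rewrite addr_ge0// mulr_ge0 ?ell2_norm_ge0.
- move=> x; apply: (le_trans (ler_ell2_normD _ _)).
  by rewrite ell2_norm_diag_op mulrDl mul1r lerD2l ell2_norm_rank_one_map.
exact: (eigenvectors_transitive Tu lmP (eigvec_close lmP) (eigvec_dense_span lmP)).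
Qed.
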